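(* Let $\mathcal{S}'=W(\mathcal{S})$ and $\mathcal{S}''=W^{2}(\mathcal{S})$. Then: (a) $\mathcal{O}_4=\mathcal{S}'\cup\mathcal{S}''$, so that the $\mathcal{G}_{\mathcal{S}}$-orbit $\mathcal{O}_4$ (of length 54) splits into two copies of the Segre variety $\mathcal{S}$. (b) The three Segre varieties $\mathcal{S},\mathcal{S}',\mathcal{S}''$ share the same 27 distinguished tangents, and hence give rise to the same distinguished $Z_3$-subgroup $\mathcal{Z}=\langle W\rangle<\operatorname{GL}(8,2)$; that is, $\mathcal{Z}$ is the centralizer in $\operatorname{GL}(8,2)$ of each of $\mathcal{G}_{\mathcal{S}}^{0},\mathcal{G}_{\mathcal{S}'}^{0},\mathcal{G}_{\mathcal{S}''}^{0}$. (c) $\mathcal{G}_{\mathcal{S}}^{0}=\mathcal{G}_{\mathcal{S}'}^{0}=\mathcal{G}_{\mathcal{S}''}^{0}$, and this group has exactly the six point-orbits $\mathcal{O}_1,\mathcal{O}_2,\mathcal{O}_3,\mathcal{S}',\mathcal{S}'',\mathcal{S}$ on $\operatorname{PG}(7,2)$. (d) $\mathcal{G}_{\mathcal{S}}$ effects the interchange $\mathcal{S}'\leftrightarrow\mathcal{S}''$, $\mathcal{G}_{\mathcal{S}'}$ effects the interchange $\mathcal{S}\leftrightarrow\mathcal{S}''$, and $\mathcal{G}_{\mathcal{S}''}$ effects the interchange $\mathcal{S}\leftrightarrow\mathcal{S}'$. In particular, with $J$ the involution interchanging $e_i\leftrightarrow e_{9-i}$ ($i=1,\dots,8$), $J\in\mathcal{G}_{\mathcal{S}}$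 interchanges $\mathcal{S}'$ and $\mathcal{S}''$; the involution $J':=WJW^{-1}=W^{2}J\in\mathcal{G}_{\mathcal{S}'}$ interchanges $\mathcal{S}$ and $\mathcal{S}''$; and the involution $J'':=W^{2}JW^{-2}=WJ\in\mathcal{G}_{\mathcal{S}''}$ interchanges $\mathcal{S}$ and $\mathcal{S}'$.
   Context: Everything is over $\operatorname{GF}(2)$. Let $V_2$ be a 2-dimensional vector space over $\operatorname{GF}(2)$ with nonzero vectors $u_0,u_1,u_2$ (so $u_2=u_0+u_1$), and $V_8=V_2\otimes V_2\otimes V_2$. Points of $\operatorname{PG}(7,2)=\mathbb{P}V_8$ are identified with nonzero vectors of $V_8$, and $\operatorname{GL}(8,2)=\operatorname{GL}(V_8)$. Put $E_{ijk}=u_i\otimes u_j\otimes u_k$ for $i,j,k\in\{0,1,2\}$. The Segre variety is the 27-point set $\mathcal{S}=\mathcal{S}_{1,1,1}(2)=\{E_{ijk}\}$. Its stabilizer in $\operatorname{GL}(V_8)$ is $\mathcal{G}_{\mathcal{S}}=\mathcal{N}\rtimes\operatorname{Sym}(3)$ (order 1296), where $\mathcal{N}=\operatorname{GL}(V_2)^3$ acts by the maps $a_1\otimes a_2\otimes a_3$ and $\operatorname{Sym}(3)$ permutes the tensor factors. Let $\mathcal{H}\cong Z_3$ be the index 2 subgroup of $\operatorname{GL}(V_2)$; $\mathcal{N}_0$ is the index 2 subgroup of $\mathcal{N}$ of those $a_1\otimes a_2\otimes a_3$ for which an even number (0 or 2) of the $a_i$ lie in $\operatorname{GL}(V_2)\setminus\mathcal{H}$;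 $\mathcal{G}_{\mathcal{S}}^{0}=\mathcal{N}_0\rtimes\operatorname{Sym}(3)$. For an image $B(\mathcal{S})$ with $B\in\operatorname{GL}(V_8)$ (again a Segre variety), $\mathcal{G}_{B(\mathcal{S})}=B\mathcal{G}_{\mathcal{S}}B^{-1}$ is its stabilizer, $\mathcal{G}_{B(\mathcal{S})}^{0}=B\mathcal{G}_{\mathcal{S}}^{0}B^{-1}$, and its distinguished tangents are the images under $B$ of those of $\mathcal{S}$. The basis is $e_1=E_{000}$, $e_2=E_{100}$, $e_3=E_{110}$, $e_4=E_{010}$, $e_5=E_{101}$, $e_6=E_{001}$, $e_7=E_{011}$, $e_8=E_{111}$. The map $W\in\operatorname{GL}(V_8)$ is given by $e_1\mapsto e_2+e_4+e_6$, $e_2\mapsto e_2+e_1+e_3+e_5$, $e_3\mapsto e_2+e_4+e_8$, $e_4\mapsto e_4+e_1+e_3+e_7$, $e_5\mapsto e_2+e_6+e_8$, $e_6\mapsto e_6+e_1+e_5+e_7$, $e_7\mapsto e_4+e_6+e_8$, $e_8\mapsto e_8+e_3+e_5+e_7$; it has order 3. Generators of $\mathcal{S}$ are the 27 lines obtained from $\mathcal{S}$ by fixing two of the three indices of $E_{ijk}$ and letting the third vary; three pass through each $p\in\mathcal{S}$ and span a 3-flat $Z(p)$. The distinguished tangent at $p$ is the line $L(p)=\{p,p',p''\}$, where $p',p''$ are the two points of $Z(p)$ lying in none of the three planes spanned by two of the generators through $p$. The point sets $\mathcal{O}_i$ (the $\mathcal{G}_{\mathcal{S}}$-orbits of points)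 are: $\mathcal{O}_5=\mathcal{S}$; $\mathcal{O}_2$ is the set of points outside $\mathcal{S}$ lying in one of the nine 3-flats spanned by the 9-point subsets of $\mathcal{S}$ obtained by fixing one of the three indices of $E_{ijk}$; $\mathcal{O}_4$ is the set of points outside $\mathcal{S}$ lying on some distinguished tangent $L(p)$; $\mathcal{O}_3$ is the set of points $E_{ijk}+E_{i'j'k'}$ with $i\ne i'$, $j\ne j'$, $k\ne k'$; and $\mathcal{O}_1$ is the set of all remaining points of $\operatorname{PG}(7,2)$. *)

(* Defs.v *)
From HB Require Import structures.
From mathcomp Require Import all_boot all_order all_algebra all_fingroup.
Set Implicit Arguments.
Unset Strict Implicit.
Unset Printing Implicit Defensive.
Import GRing.Theory.
Local Open Scope ring_scope.

Notation V2 := 'cV['F_2]_2.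
Notation V8 := 'cV['F_2]_8.
Notation GL2 := {'GL_2['F_2]}.
Notation GL8 := {'GL_8['F_2]}.

Definition u (i : 'I_3) : V2 :=
  nth 0 [:: delta_mx 0 0; delta_mx 1 0; delta_mx 0 0 + delta_mx 1 0] i.

(* V8 is coordinatised by the basis e_1, ..., e_8 below: the entry of bits at  *)
(* position n (from 0) is the triple (i, j, k) such that e_(n+1) = u_i (x) u_j *)
(* (x) u_k, so the n-th coordinate of x_0 (x) x_1 (x) x_2 is the product of    *)
(* the i-th, j-th and k-th coordinates of x_0, x_1 and x_2 in the basis u_0,   *)
(* u_1.                                                                        *)
Definition bits : seq (seq 'I_2) :=
  [:: [:: 0; 0; 0]; [:: 1; 0; 0]; [:: 1; 1; 0]; [:: 0; 1; 0];
      [:: 1; 0; 1]; [:: 0; 0; 1]; [:: 0; 1; 1]; [:: 1; 1; 1]].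

Definition tensor (x : 'I_3 -> V2) : V8 :=
  \col_(n < 8) \prod_(m < 3) x m (nth 0 (nth [::] bits n) m) 0.

Notation triple := {ffun 'I_3 -> 'I_3}.

Definition E (t : 'I_3 -> 'I_3) : V8 := tensor (fun m => u (t m)).

Definition E3 (i j k : 'I_3) : V8 := E (tnth [tuple i; j; k]).

(* Numbered from 1; the value at 0 is irrelevant.                              *)
Definition e (n : nat) : V8 :=
  nth 0 [:: E3 0 0 0; E3 1 0 0; E3 1 1 0; E3 0 1 0;
            E3 1 0 1; E3 0 0 1; E3 0 1 1; E3 1 1 1] n.-1.
Arguments e : simpl never.

Definition W_images : seq V8 :=
  [:: e 2 + e 4 + e 6; e 2 + e 1 + e 3 + e 5; e 2 + e 4 + e 8;
      e 4 + e 1 + e 3 + e 7; e 2 + e 6 + e 8; e 6 + e 1 + e 5 + e 7;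
      e 4 + e 6 + e 8; e 8 + e 3 + e 5 + e 7].

Definition J_images : seq V8 := [seq e (9 - i) | i <- iota 1 8].

(* The matrix whose columns are the vectors of s; it sends e_(j+1) to the j-th *)
(* vector of s because e_1, ..., e_8 is the standard basis of V8, see          *)
(* images_mx_e.                                                                *)
Definition images_mx (s : seq V8) : 'M['F_2]_8 := \matrix_(i, j) s`_j i 0.

Lemma eE n (i : 'I_8) : (n < 8)%N -> e n.+1 i 0 = (i == n :> nat)%:R.
Proof.
move=> ltn.
have -> : e n.+1 =
    E (fun m => widen_ord (isT : 2 <= 3)%N (nth 0 (nth [::] bits n) m)).
  rewrite /e /=.
  do 8 ?[case: n ltn => [|n] ltn //=]; rewrite /E3 /E; apply/colP=> r;
  rewrite !mxE; apply: eq_bigr=> m _; congr ((u _) _ _); apply: val_inj;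
  by case: m => [[|[|[|m]]] lm].
rewrite mxE !big_ord_recl big_ord0 /=.
by do 8 ?[case: n ltn => [|n] ltn //=];
  case: i => [[|[|[|[|[|[|[|[|i]]]]]]]] li] //=;
  rewrite /u /= !mxE /= ?(mulr0, mul0r, mulr1).
Qed.

Lemma images_mx_e s n : (n < 8)%N -> images_mx s *m e n.+1 = s`_n.
Proof.
move=> ltn; apply/colP=> i; rewrite mxE (bigD1 (Ordinal ltn)) //= mxE.
rewrite eE // eqxx mulr1 big1 ?addr0 // => j nej; rewrite eE //.
by rewrite -[n]/(nat_of_ord (Ordinal ltn)) (inj_eq val_inj) (negPf nej) mulr0.
Qed.

Lemma W_cubed : images_mx W_images *m images_mx W_images *m images_mx W_images
  = 1%:M.
Proof.
have WE (i j : 'I_8) : images_mx W_images i j = (nat_of_ord i \in nth [::]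
    [:: [:: 1; 3; 5]; [:: 1; 0; 2; 4]; [:: 1; 3; 7]; [:: 3; 0; 2; 6];
        [:: 1; 5; 7]; [:: 5; 0; 4; 6]; [:: 3; 5; 7]; [:: 7; 2; 4; 6]]%N j)%:R.
  have addE (A B : V8) k l : (A + B) k l = A k l + B k l by rewrite mxE.
  rewrite mxE /W_images.
  by case: j => [[|[|[|[|[|[|[|[|j]]]]]]]] lj] //=; rewrite !addE !eE //;
    case: i => [[|[|[|[|[|[|[|[|i]]]]]]]] li] //=; apply/eqP; vm_compute.
apply/matrixP=> i j; rewrite !mxE; under eq_bigr do rewrite mxE WE.
under eq_bigr do under eq_bigr do rewrite !WE.
rewrite !big_ord_recl !big_ord0 /=.
by case: j => [[|[|[|[|[|[|[|[|j]]]]]]]] lj] //=;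
  case: i => [[|[|[|[|[|[|[|[|i]]]]]]]] li] //=; apply/eqP; vm_compute.
Qed.

Lemma J_squared : images_mx J_images *m images_mx J_images = 1%:M.
Proof.
have JE (i j : 'I_8) : images_mx J_images i j = (i == (7 - j)%N :> nat)%:R.
  by rewrite mxE; case: j => [[|[|[|[|[|[|[|[|j]]]]]]]] lj] //=; exact: eE.
apply/matrixP=> i j; rewrite !mxE; under eq_bigr do rewrite !JE.
rewrite !big_ord_recl !big_ord0 /=.
by case: j => [[|[|[|[|[|[|[|[|j]]]]]]]] lj] //=;
  case: i => [[|[|[|[|[|[|[|[|i]]]]]]]] li] //=; apply/eqP; vm_compute.
Qed.

Lemma W_unit : images_mx W_images \is a GRing.unit.
Proof. by case/mulmx1_unit: W_cubed. Qed.

Lemma J_unit : images_mx J_images \is a GRing.unit.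
Proof. by case/mulmx1_unit: J_squared. Qed.

Definition W : GL8 := Sub (images_mx W_images) W_unit.
Definition J : GL8 := Sub (images_mx J_images) J_unit.

(* Matrices act on columns from the left, so that the group law of GL8 is      *)
(* composition of maps (the right factor is applied first).                    *)
Definition im (B : GL8) (A : {set V8}) : {set V8} := [set GLval B *m v | v in A].

(* The action of GL8 on V8 turned into a right action, for use with orbit and  *)
(* 'N(_ | _); orbits and stabilisers of subgroups are those of the left action.*)
Definition vact (v : V8) (g : GL8) : V8 := GLval g^-1%g *m v.

Fact vact_is_action : is_action setT vact.
Proof.
split=> [g v w eq_gvw | v g h _ _]; last by rewrite /vact invMg GL_MxE mulmxA.
have gK x : GLval g *m vact x g = x.
  by rewrite /vact mulmxA -GL_MxE mulgV mul1mx.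
by rewrite -(gK v) eq_gvw gK.
Qed.

Canonical GL8_action := Action vact_is_action.

Definition stab (A : {set V8}) : {set GL8} := 'N(A | GL8_action)%g.

Definition points : {set V8} := [set v | v != 0].

Definition point_orbits (G : {set GL8}) : {set {set V8}} :=
  [set orbit GL8_action G p | p in points].

Definition pspan (A : {set V8}) : {set V8} :=
  [set v in points | v \in <<enum A>>%VS].

Definition segre : {set V8} := [set E t | t : triple].

Definition index2 : {set GL2} :=
  (* there is exactly one subgroup of index 2 *)
  \bigcup_(K : {group GL2} | #|'GL_2['F_2] : K|%g == 2%N) K.

(* g = a_0 (x) a_1 (x) a_2                                                     *)
Definition is_tensor (g : GL8) (a : 'I_3 -> GL2) : bool :=
  [forall x : {ffun 'I_3 -> V2},
     GLval g *m tensor x == tensor (fun m => GLval (a m) *m x m)].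

Definition N0 : {set GL8} :=
  [set g : GL8 | [exists a : {ffun 'I_3 -> GL2},
     is_tensor g a && ~~ odd #|[set m | a m \notin index2]|]].

Definition factor_perms : {set GL8} :=
  [set g : GL8 | [exists s : 'S_3, [forall x : {ffun 'I_3 -> V2},
     GLval g *m tensor x == tensor (fun m => x (s m))]]].

Definition G0_segre : {set GL8} := (N0 * factor_perms)%g.

(* G^0 of the Segre variety im B segre; note that G :^ B^-1 is B G B^-1.       *)
Definition G0 (B : GL8) : {set GL8} := (G0_segre :^ B^-1)%g.

Definition generators : {set {set V8}} :=
  [set [set E t' | t' : triple & [forall l, (l != m) ==> (t' l == t l)]]
     | m : 'I_3, t : triple].

Definition generators_at (p : V8) : {set {set V8}} :=
  [set l in generators | p \in l].

Definition Z (p : V8) : {set V8} := pspan (cover (generators_at p)).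

Definition planes_at (p : V8) : {set {set V8}} :=
  [set pspan (l :|: l') | l in generators_at p, l' in generators_at p & l != l'].

Definition tangent (p : V8) : {set V8} := p |: (Z p :\: cover (planes_at p)).

Definition tangents_segre : {set {set V8}} := [set tangent p | p in segre].

(* The distinguished tangents of im B segre.                                   *)
Definition tangents (B : GL8) : {set {set V8}} :=
  [set im B L | L : {set V8} in tangents_segre].

Definition O2 : {set V8} :=
  (\bigcup_(m : 'I_3) \bigcup_(c : 'I_3)
     pspan [set E t | t : triple & t m == c]) :\: segre.

Definition O3 : {set V8} :=
  [set E t.1 + E t.2 | t : triple * triple & [forall m, t.1 m != t.2 m]].

Definition O4 : {set V8} := cover tangents_segre :\: segre.

Definition O1 : {set V8} := points :\: (O2 :|: O3 :|: O4 :|: segre).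

Definition interchanges (g : GL8) (A B : {set V8}) : Prop :=
  im g A = B /\ im g B = A.

Definition effects_interchange (G : {set GL8}) (A B : {set V8}) : Prop :=
  (forall g, g \in G -> [set im g A; im g B] = [set A; B]) /\
  (exists2 g, g \in G & interchanges g A B).

(* Main.v *)
Require Import Defs.
From mathcomp Require Import all_boot all_order all_algebra all_fingroup.
From mathcomp Require Import cyclic.
From Stdlib Require BinNat Nnat.
Local Open Scope group_scope.

(** Let zeta be the linear map u_0 -> u_1 -> u_2 -> u_0 of V_2, which generates
    the subgroup H, and let zeta_m be zeta acting on the m-th tensor factor.
    Everything rests on the identity W = zeta_1 + zeta_2 + zeta_3 [W_tensor].

    - W commutes with G^0.  Factor permutations permute the summands.  An element
      a of GL(V_2) satisfies a zeta = zeta a if it lies in H and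
      a zeta = (zeta + 1) a otherwise [twist], so a_1 (x) a_2 (x) a_3 carries W to
      W plus the number of a_i outside H, which vanishes in GF(2) on N_0 [W_G0].
    - On a point p of S, the vector W p is the sum of one further point from each
      generator through p; hence L(p) = {p, W p, W^2 p} [tangentE].  So W
      preserves each tangent, and O_4 is the union of W(S) and W^2(S).
    - Centraliser: if c commutes with G^0, then c p is fixed by the stabiliser of p
      in G^0, and the fixed vectors of that stabiliser form L(p).  Thus c p = w p
      for a power w of W, and c = w because G^0 is transitive on S and S spans
      [centralizer_G0].
    - The stabiliser of S normalises <W> [stab_normalises_W].  If g stabilises S,
      then g maps L(p) to L(g p), so g W p is W g p or W^2 g p.  The choice is the
      same at two points p, q of one generator: otherwise g W (p + q) would be
      W g p + W^2 g q, which is neither W g (p + q) nor W^2 g (p + q) as W fixes no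
      point of S.  The generators connect S, so g W = W g or g W = W^2 g on all
      of V_8.  This gives the interchanges; J realises the second case, and
      conjugation by W and W^2 transports the result to the other two varieties.
    - Orbits: each of the six sets is G^0-invariant because elements of G^0 act
      monomially on the E_ijk [G0_E] or commute with W, and it is a single orbit by
      a search with four generators.

    The finite verifications (incidences at 27 points, subspaces with few
    generators, orbits of length at most 108) are carried out on binary numbers:
    the injective map [code] reads the coordinates of a vector as the bits of a
    number and turns addition into exclusive or. *)

Section Segre.
Set Implicit Arguments. Unset Strict Implicit.
Import GRing.Theory.
Local Open Scope ring_scope.

Notation num := BinNums.N.
Notation lxor := BinNat.N.lxor.
Notation testbit := BinNat.N.testbit.
Notation of_nat n := (BinNat.N.of_nat n).
Notation ap g v := ((GLval g *m (v : V8))%R).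
Notation apf g := (fun v : V8 => ap g v).

(** * Binary codes of vectors and of linear maps *)

Fixpoint of_bits (s : seq bool) : num :=
  if s is b :: s' then
    (if b then BinNat.N.succ_double else BinNat.N.double) (of_bits s')
  else BinNums.N0.

Definition code (v : V8) : num := of_bits [seq v i 0 == 1 | i <- enum 'I_8].

Lemma testbit_of_bits s i : testbit (of_bits s) (of_nat i) = nth false s i.
Proof.
elim: s i => [|b s IHs] i; first by rewrite nth_nil; case: i.
case: i => [|i]; rewrite [of_bits _]/=.
  by case: b => /=; case: (of_bits s).
rewrite Nnat.Nat2N.inj_succ /= -IHs.
case: b.
  rewrite BinNat.N.succ_double_spec BinNat.N.testbit_odd_succ //.
  exact: BinNat.N.le_0_l.
rewrite BinNat.N.double_spec BinNat.N.testbit_even_succ //.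
exact: BinNat.N.le_0_l.
Qed.

Lemma testbit_code v (i : 'I_8) : testbit (code v) (of_nat i) = (v i 0 == 1).
Proof. by rewrite testbit_of_bits (nth_map i) ?size_enum_ord // nth_ord_enum. Qed.

Lemma F2P (x : 'F_2) : x = (x == 1)%:R.
Proof. by case: x => [[|[|]]] // lt; apply/eqP; vm_compute. Qed.

Lemma code_inj : injective code.
Proof.
move=> v w eq_vw; apply/colP=> i.
by rewrite [LHS]F2P [RHS]F2P -!testbit_code eq_vw.
Qed.

Lemma F2_xor (x y : 'F_2) : (x + y == 1) = xorb (x == 1) (y == 1).
Proof. by case: x y => [[|[|]]] // ? [[|[|]]]. Qed.

Lemma codeD v w : code (v + w) = lxor (code v) (code w).
Proof.
apply: BinNat.N.bits_inj => k; rewrite -[k]Nnat.N2Nat.id.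
rewrite BinNat.N.lxor_spec; set i := BinNat.N.to_nat k.
have [lti|lei] := ltnP i 8; last first.
  by rewrite !testbit_of_bits !nth_default // size_map size_enum_ord.
by rewrite -[i]/(nat_of_ord (Ordinal lti)) !testbit_code mxE F2_xor.
Qed.

Lemma code0 : code 0 = BinNums.N0.
Proof. by rewrite -[0 in LHS](addr0 (0 : V8)) codeD BinNat.N.lxor_nilpotent. Qed.

Lemma code_eq0 v : (code v == BinNums.N0) = (v == 0).
Proof. by rewrite -code0 (inj_eq code_inj). Qed.

(** The number [nth _ M j] is the code of the image of e_(j+1), so M lists the
    columns of a matrix. *)
Definition mulc (M : seq num) (n : num) : num :=
  foldr (fun j => lxor (if testbit n (of_nat j) then nth BinNums.N0 M j
                        else BinNums.N0)) BinNums.N0 (iota 0 8).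

(** Stated with [foldr] because, unlike the big operators, it computes. *)
Lemma code_sum (I : Type) (r : seq I) (F : I -> V8) :
  code (\sum_(i <- r) F i)
    = foldr (fun i => lxor (code (F i))) BinNums.N0 r.
Proof.
by elim: r => [|i r IHr]; rewrite ?big_nil ?code0 // big_cons codeD IHr.
Qed.

Lemma code_mulmx (A : 'M_8) M v :
  (forall j, (j < 8)%N -> code (A *m e j.+1) = nth BinNums.N0 M j) ->
  code (A *m v) = mulc M (code v).
Proof.
move=> AM; have -> : A *m v = \sum_(j <- enum 'I_8) v j 0 *: (A *m e j.+1).
  rewrite big_enum /=; under eq_bigr do rewrite scalemxAr.
  rewrite -mulmx_sumr; congr (A *m _); apply/colP=> i.
  rewrite summxE (bigD1 i) //= mxE eE // eqxx mulr1 big1 ?addr0 // => j nej.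
  by rewrite mxE eE // eq_sym (inj_eq val_inj) (negPf nej) mulr0.
rewrite code_sum /mulc -val_enum_ord foldr_map.
elim: (enum 'I_8) => //= j r ->; congr lxor.
rewrite testbit_code [v j 0]F2P; case: (v j 0 == 1); rewrite /= ?scale1r ?AM //.
by rewrite scale0r code0.
Qed.

(** * Codes of the points of S *)

(** The indices (i, j, k) of the vectors e_1, ..., e_8 = E_ijk. *)
Definition basis : seq (seq nat) :=
  [:: [:: 0; 0; 0]; [:: 1; 0; 0]; [:: 1; 1; 0]; [:: 0; 1; 0];
      [:: 1; 0; 1]; [:: 0; 0; 1]; [:: 0; 1; 1]; [:: 1; 1; 1]]%N.

Definition triples : seq (seq nat) :=
  [seq i :: jk | i <- iota 0 3, jk <- [seq [:: j; k] | j <- iota 0 3, k <- iota 0 3]].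

(** Triples of indices as lists of numbers, which evaluate without meeting the
    proofs stored in ordinals; [pt] goes back. *)
Definition tseq (t : 'I_3 -> 'I_3) : seq nat := [seq val (t m) | m <- enum 'I_3].

(** The coordinate number b of u_i, where u_2 = u_0 + u_1 has both. *)
Definition ubit (i b : nat) : bool := (i == 2%N) || (i == b).

Definition codeE (t : seq nat) : num := of_bits [seq all2 ubit t b | b <- basis].

Lemma tseq_triples t : tseq t \in triples.
Proof.
rewrite /tseq !enum_ordSl enum_ord0 /=.
by do 3!case: (t _) => [[|[|[|?]]] ?].
Qed.

Lemma size_tseq t : size (tseq t) = 3%N.
Proof. by rewrite size_map size_enum_ord. Qed.

Lemma nth_tseq t (m : 'I_3) : nth 0%N (tseq t) m = t m.
Proof. by rewrite (nth_map m) ?size_enum_ord // nth_ord_enum. Qed.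

Lemma uE i (b : 'I_2) : u i b 0 = (ubit i b)%:R.
Proof.
by case: i b => [[|[|[|?]]] ?] [[|[|?]] ?]; rewrite /u /= ?mxE /= ?addr0 ?add0r.
Qed.

Lemma code_E t : code (E t) = codeE (tseq t).
Proof.
congr of_bits; apply: (@eq_from_nth _ false); rewrite size_map size_enum_ord //.
move=> i lti; rewrite (nth_map (Ordinal lti)) ?size_enum_ord //.
rewrite -[X in nth _ (enum _) X]/(nat_of_ord (Ordinal lti)) nth_ord_enum.
rewrite /E mxE; under eq_bigr do rewrite uE.
rewrite !big_ord_recl big_ord0 mulr1 -!natrM !mulnb /tseq !enum_ordSl enum_ord0.
by case: i lti => [|[|[|[|[|[|[|[|?]]]]]]]] //= lti;
  rewrite andbT; case: ([&& _, _ & _]).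
Qed.

Lemma e_E n : (n < 8)%N -> exists t : triple, e n.+1 = E t.
Proof.
have ex i j k : exists t : triple, E3 i j k = E t.
  exists (finfun (tnth [tuple i; j; k])); rewrite /E3 /E /tensor.
  by apply/colP=> r; rewrite !mxE; under [RHS]eq_bigr do rewrite ffunE.
by rewrite /e; do 8 ?[case: n => [|n] //=].
Qed.

Lemma code_e n : (n < 8)%N -> code (e n.+1) = codeE (nth [::] basis n).
Proof.
move=> ltn8; rewrite -[RHS]/(of_bits _); congr of_bits.
apply: (@eq_from_nth _ false); rewrite size_map size_enum_ord //.
move=> i lti; rewrite (nth_map (Ordinal lti)) ?size_enum_ord //.
rewrite -[X in nth _ (enum _) X]/(nat_of_ord (Ordinal lti)) nth_ord_enum eE //.
rewrite (nth_map [::]) //.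
by do 8?[case: n ltn8 => [|n] ltn8 //]; do 8?[case: i lti => [|i] lti //].
Qed.

(** The points of S span V_8, since e_1, ..., e_8 are among them. *)
Lemma mx_E_inj (A B : 'M_8) :
  (forall t : triple, A *m E t = B *m E t) -> A = B.
Proof.
move=> eqAB; apply/matrixP=> i j.
have col (C : 'M_8) : C i j = (C *m e j.+1) i 0.
  rewrite mxE (bigD1 j) //= eE // eqxx mulr1 big1 ?addr0 // => k nek.
  by rewrite eE // (inj_eq val_inj) (negPf nek) mulr0.
by rewrite !col; have [t ->] := e_E (ltn_ord j); rewrite eqAB.
Qed.

Definition pt (t : seq nat) : triple := [ffun m : 'I_3 => inord (nth 0%N t m)].

Lemma tseq_pt t : t \in triples -> tseq (pt t) = t.
Proof.
have /allP h : all (fun t => (size t == 3) && all (ltn^~ 3) t) triples by [].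
case/h/andP=> /eqP sz /allP lt3.
apply: (@eq_from_nth _ 0%N); first by rewrite size_map size_enum_ord.
move=> i; rewrite size_map size_enum_ord => lti.
rewrite -[i]/(nat_of_ord (Ordinal lti)) nth_tseq ffunE inordK //.
by apply/lt3/mem_nth; rewrite sz.
Qed.

(** * The action on V8, stabilisers and orbits *)

(** The general facts about groups are restated over an arbitrary finite ring:
    over GF(2), where the multiplication of a group can be reached through several
    structures, unification would unfold the arithmetic of the ring. *)
Lemma GL_groupM (F : finComUnitRingType) n (G : {group {'GL_n[F]}}) (g h : {'GL_n[F]}) :
  g \in G -> h \in G -> (g * h)%g \in G.
Proof. exact: groupM. Qed.

Lemma GL_groupV (F : finComUnitRingType) n (G : {group {'GL_n[F]}}) (g : {'GL_n[F]}) :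
  (g^-1%g \in G) = (g \in G).
Proof. exact: groupV. Qed.

Lemma apM (g h : GL8) v : ap (g * h)%g v = ap g (ap h v).
Proof. by rewrite GL_MxE mulmxA. Qed.

Lemma ap1 v : ap (1 : GL8)%g v = v.
Proof. by rewrite GL_1E mul1mx. Qed.

Lemma apK (g : GL8) : cancel (apf g) (apf g^-1%g).
Proof. by move=> v; rewrite -apM mulVg ap1. Qed.

Lemma apVK (g : GL8) : cancel (apf g^-1%g) (apf g).
Proof. by move=> v; rewrite -apM mulgV ap1. Qed.

Lemma ap_inj (g : GL8) : injective (apf g).
Proof. exact: can_inj (apK g). Qed.

Lemma GL8_E_inj (g h : GL8) : (forall t : triple, ap g (E t) = ap h (E t)) -> g = h.
Proof. by move=> eq_gh; apply/val_inj/mx_E_inj. Qed.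

Lemma mem_im (g : GL8) A v : (v \in im g A) = (ap g^-1%g v \in A).
Proof.
apply/imsetP/idP => [[w Aw ->]|Av]; first by rewrite apK.
by exists (ap g^-1%g v); rewrite ?apVK.
Qed.

Lemma ap_im (g : GL8) (A : {set V8}) v : (ap g v \in im g A) = (v \in A).
Proof. by rewrite mem_im apK. Qed.

Lemma imM (g h : GL8) A : im (g * h)%g A = im g (im h A).
Proof. by apply/setP=> v; rewrite !mem_im invMg apM. Qed.

Lemma im1 A : im 1%g A = A.
Proof. by apply/setP=> v; rewrite mem_im invg1 ap1. Qed.

Lemma card_im (g : GL8) A : #|im g A| = #|A|.
Proof. exact/card_imset/ap_inj. Qed.

Lemma im_sub_eq (g : GL8) (A : {set V8}) : {in A, forall v, ap g v \in A} -> im g A = A.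
Proof.
move=> gA; apply/eqP; rewrite eqEcard card_im leqnn andbT.
by apply/subsetP=> _ /imsetP[v /gA Agv ->].
Qed.

Lemma stabP (g : GL8) (A : {set V8}) : reflect (im g A = A) (g \in stab A).
Proof.
apply: (iffP astabsP) => [gA | gA v]; last by rewrite -[in RHS]gA mem_im.
by apply/setP=> v; rewrite mem_im -gA.
Qed.

Lemma GL8_actionE v (g : GL8) : GL8_action v g^-1%g = ap g v.
Proof. by rewrite -[GL8_action v _]/(ap g^-1^-1%g v) invgK. Qed.

(** [GL8_action] lets g act as v |-> g^-1 v.  Its orbits under a group are those of
    the left action, in terms of which the hypotheses are stated. *)
Lemma orbit_eq (G : {group GL8}) (A : {set V8}) (r : V8) :
  {in G & A, forall (g : GL8) v, ap g v \in A} ->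
  {in A, forall v, exists2 g : GL8, g \in G & v = ap g r} ->
  {in A, forall p, orbit GL8_action G p = A}.
Proof.
move=> invA trA p Ap; apply/setP=> v; apply/orbitP/idP => [[g Gg <-]|Av].
  by rewrite -[g]invgK GL8_actionE invA ?GL_groupV.
have [[g Gg vE] [h Gh pE]] := (trA v Av, trA p Ap).
have Ghg : (h * g^-1)%g \in G by rewrite GL_groupM ?GL_groupV.
exists (h * g^-1)%g => //.
by rewrite -[(h * _)%g]invgK GL8_actionE invMg invgK apM pE apK.
Qed.

(** * Decomposable vectors *)

Definition upd (T : Type) (x : 'I_3 -> T) m (v : T) : 'I_3 -> T :=
  fun k => if k == m then v else x k.

Lemma tensor_ext x y : x =1 y -> tensor x = tensor y.
Proof.
by move=> xy; apply/colP=> r; rewrite !mxE; apply: eq_bigr => m _; rewrite xy.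
Qed.

Lemma tensor_updD x m v w :
  tensor (upd x m (v + w)) = tensor (upd x m v) + tensor (upd x m w).
Proof.
apply/colP=> r; rewrite !mxE !(bigD1 (P := predT) m) //= /upd eqxx mxE mulrDl.
by congr (_ * _ + _ * _); apply: eq_bigr => k /negPf->.
Qed.

Lemma tensor_eq0 x m : x m = 0 -> tensor x = 0.
Proof. by move=> x0; apply/colP=> r; rewrite !mxE (bigD1 m) //= x0 mxE mul0r. Qed.

Lemma u_neq0 i : u i != 0.
Proof.
apply/eqP=> /colP ui; move: (ui 0) (ui 1); rewrite !uE !mxE.
by case: i {ui} => [[|[|[|?]]] ?].
Qed.

Lemma uP (v : V2) : v != 0 -> exists i, v = u i.
Proof.
move=> nz; have [i vi] : exists i : 'I_3, forall b, v b 0 = (ubit i b)%:R.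
  have all2 (P : 'I_2 -> Prop) : P 0 -> P 1 -> forall b, P b.
    move=> P0 P1 [[|[|//]] b]; [move: P0|move: P1]; congr P; exact: val_inj.
  case: (boolP (v 0 0 == 1)) (F2P (v 0 0)) => _ v0;
  case: (boolP (v 1 0 == 1)) (F2P (v 1 0)) => _ v1.
  - by exists ord_max; apply: all2.
  - by exists 0; apply: all2.
  - by exists 1; apply: all2.
  case/eqP: nz; apply/colP; apply: all2; rewrite mxE; [exact: v0|exact: v1].
by exists i; apply/colP=> b; rewrite vi uE.
Qed.

(** A linear identity between decomposable vectors therefore only has to be
    checked on S. *)
Lemma tensor_cases (x : 'I_3 -> V2) :
  (exists m, x m = 0) \/ exists t : triple, x =1 u \o t.
Proof.
have [/existsP[m /eqP xm0]|] := boolP [exists m, x m == 0]; first by left; exists m.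
rewrite negb_exists => /forallP nz; right.
have ex m : exists i, x m == u i by have [i ->] := uP (nz m); exists i.
exists [ffun m => xchoose (ex m)] => m /=.
by rewrite ffunE; apply/eqP/(xchooseP (ex m)).
Qed.

Lemma is_tensorP (g : GL8) (a : 'I_3 -> GL2) :
  reflect (forall x, ap g (tensor x) = tensor (fun m => GLval (a m) *m x m))
          (is_tensor g a).
Proof.
apply: (iffP forallP) => [ga x|ga x]; last by rewrite ga.
have := ga (finfun x); rewrite (@tensor_ext (finfun x) x) => [/eqP->|m].
  by apply: tensor_ext => m; rewrite ffunE.
by rewrite ffunE.
Qed.

(** * GL(V_2) and its subgroup of index 2 *)

(** A subgroup K of index 2 is normal and contains all squares, hence z = (z^2)^2,
    so K = <z> by counting; the centraliser of z contains <z> and is proper because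
    of t, so it is <z> too. *)
Lemma index2_groups (gT : finGroupType) (z t : gT) :
  #|[set: gT]| = 6%N -> z != 1%g -> (z ^+ 3 = 1)%g -> ~ commute z t ->
  (\bigcup_(K : {group gT} | #|[set: gT] : K|%g == 2%N) K = 'C[z])%g.
Proof.
move=> G6 nt_z z3 nc_zt; have oz : #[z]%g = 3%N by apply: nt_prime_order => //; exact/eqP.
have CE : 'C[z]%g = <[z]>%g.
  apply/esym/eqP; rewrite eqEcard cycle_subG cent1id /= -orderE oz.
  have ltC : (#|'C[z]%g| < 6)%N.
    rewrite -G6; apply/proper_card/properP; split; first exact: subsetT.
    exists t; [by rewrite inE | by apply/cent1P=> /commute_sym].
  have : (#|'C[z]%g| %| 6)%N by rewrite -G6 cardSg ?subsetT.
  by move: ltC; case: #|_| => [|[|[|[|[|[|]]]]]].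
apply/setP=> x; rewrite CE; apply/bigcupP/idP => [[K /eqP iK Kx] | zx]; last first.
  by exists <[z]>%G => //; rewrite -divgS ?subsetT // G6 -orderE oz.
have nKG : (K <| [set: gT])%g by apply: index2_normal; rewrite ?subsetT.
have sq y : (y ^+ 2)%g \in K.
  have nKy : y \in 'N(K)%g by rewrite (subsetP (normal_norm nKG)) ?inE.
  apply: coset_idr; first by rewrite groupX.
  rewrite morphX // -iK -card_quotient ?normal_norm //.
  by rewrite expg_cardG // mem_quotient ?inE.
suff -> : <[z]>%g = K by [].
apply/eqP; rewrite eqEcard cycle_subG -orderE oz; apply/andP; split.
  by rewrite -[z]mulg1 -z3 -expgS (expgM z 2 2).
by have := Lagrange (subsetT K); rewrite iK G6; case: #|_| => [|[|[|[|]]]].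
Qed.

Definition rot (i : 'I_3) : 'I_3 := i + 1.

Definition zeta_mx : 'M['F_2]_2 := \matrix_(i, j) u (lift ord0 j) i 0.

(** The transvection that fixes u_0 and exchanges u_1 and u_2. *)
Definition tau_mx : 'M['F_2]_2 := \matrix_(i, j) u (nth 0 [:: 0; ord_max] j) i 0.

Lemma mul_uE (f : 'I_2 -> 'I_3) i b :
  ((\matrix_(i, j) u (f j) i 0) *m u i : V2) b 0
    = (xorb (ubit (f 0) b && ubit i 0) (ubit (f 1) b && ubit i 1))%:R.
Proof.
rewrite mxE !big_ord_recl big_ord0 addr0 !mxE !uE.
rewrite [lift _ _](_ : _ = 1); last exact: val_inj.
rewrite [0%R](_ : _ = ord0 :> 'I_2) //.
by case: ubit; case: ubit; case: ubit; case: ubit; apply/eqP.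
Qed.

Lemma zeta_u i : zeta_mx *m u i = u (rot i).
Proof.
apply/colP=> b; rewrite mul_uE uE; congr (_%:R : 'F_2); move: i b.
by case=> [[|[|[|?]]] ?]; case=> [[|[|?]] ?].
Qed.

Lemma tau_u i : tau_mx *m u i = u (- i).
Proof.
apply/colP=> b; rewrite mul_uE uE; congr (_%:R : 'F_2); move: i b.
by case=> [[|[|[|?]]] ?]; case=> [[|[|?]] ?].
Qed.

Lemma u_sum i : u i + u (rot i) = u (rot (rot i)).
Proof.
apply/colP=> b; rewrite mxE !uE; move: i b.
by case=> [[|[|[|?]]] ?]; case=> [[|[|?]] ?]; apply/eqP.
Qed.

Lemma rot3 i : rot (rot (rot i)) = i.
Proof. by apply/val_inj; case: i => [[|[|[|?]]] ?]. Qed.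

(** Any two of the three vectors u_i form a basis. *)
Lemma mx2_inj (A B : 'M['F_2]_2) i : A *m u i = B *m u i ->
  A *m u (rot i) = B *m u (rot i) -> A = B.
Proof.
move=> eq0 eq1; have eqAB j : A *m u j = B *m u j.
  have eq2 : A *m u (rot (rot i)) = B *m u (rot (rot i)).
    by rewrite -u_sum !mulmxDr eq0 eq1.
  have : [|| j == i, j == rot i | j == rot (rot i)].
    by case: i j {eq0 eq1 eq2} => [[|[|[|?]]] ?] [[|[|[|?]]] ?].
  by case/or3P=> /eqP->.
apply/matrixP=> r c.
have col (C : 'M['F_2]_2) : C r c = (C *m u (inord c)) r 0.
  rewrite mxE (bigD1 c) //= uE inordK ?(ltn_trans (ltn_ord c)) // big1 ?addr0.
    by rewrite /ubit eqxx orbT mulr1.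
  move=> k nek; rewrite uE inordK ?(ltn_trans (ltn_ord c)) // /ubit.
  have /negPf-> : (c : nat) != k by rewrite (inj_eq val_inj) eq_sym.
  by rewrite orbF ltn_eqF ?mulr0.
by rewrite !col eqAB.
Qed.

Lemma zeta_cubed : zeta_mx *m zeta_mx *m zeta_mx = 1%:M.
Proof. by apply: (@mx2_inj _ _ 0); rewrite -!mulmxA mul1mx !zeta_u rot3. Qed.

Lemma tau_squared : tau_mx *m tau_mx = 1%:M.
Proof. by apply: (@mx2_inj _ _ 0); rewrite -!mulmxA mul1mx !tau_u opprK. Qed.

Lemma zeta_unit : zeta_mx \is a GRing.unit.
Proof. by case/mulmx1_unit: zeta_cubed. Qed.

Lemma tau_unit : tau_mx \is a GRing.unit.
Proof. by case/mulmx1_unit: tau_squared. Qed.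

Definition zeta : GL2 := Sub zeta_mx zeta_unit.
Definition tau : GL2 := Sub tau_mx tau_unit.

Lemma GL_in_cent1 (F : finComUnitRingType) n (a z : {'GL_n[F]}) :
  (a \in 'C[z]%g) = (GLval a *m GLval z == GLval z *m GLval a).
Proof.
apply/cent1P/eqP => [zaC | zaC]; first by rewrite -!GL_MxE zaC.
by apply: val_inj; rewrite /= -[LHS]GL_MxE -[RHS]GL_MxE.
Qed.

Lemma GL2_index2 (a : GL2) :
  (a \in index2) = (GLval a *m zeta_mx == zeta_mx *m GLval a).
Proof.
rewrite -[zeta_mx]/(GLval zeta) -GL_in_cent1; suff -> : index2 = 'C[zeta]%g by [].
rewrite /index2 /=; apply: (@index2_groups _ zeta tau).
- by rewrite -/('GL_2['F_2]%G : {set _}) card_GL_2 card_Fp.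
- apply/eqP=> /(congr1 (fun g : GL2 => GLval g *m u 0)).
  rewrite GL_1E mul1mx -[GLval _]/zeta_mx zeta_u => /colP/(_ 0).
  by rewrite !uE.
- apply: val_inj; rewrite -[LHS]/(GLval (zeta * (zeta * zeta)))%g !GL_MxE mulmxA.
  exact: zeta_cubed.
move=> /(congr1 (fun g : GL2 => GLval g *m u 0)); rewrite !GL_MxE -!mulmxA.
rewrite -[GLval zeta]/zeta_mx -[GLval tau]/tau_mx !(tau_u, zeta_u) => /colP/(_ 0).
by rewrite !uE.
Qed.

(** * The group G^0 *)

(** The class of a modulo H, as a scalar. *)
Definition tw (a : GL2) : 'F_2 := (a \notin index2)%:R.

Lemma GL2_u (a : GL2) i : exists j, GLval a *m u i = u j.
Proof.
apply: uP; apply/eqP=> au0; case/eqP: (u_neq0 i).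
have -> : u i = GLval (a^-1 * a)%g *m u i by rewrite mulVg GL_1E mul1mx.
by rewrite GL_MxE -mulmxA au0 mulmx0.
Qed.

Lemma GL2_u_inj (a : GL2) : injective (fun v : V2 => GLval a *m v).
Proof.
apply: can_inj (fun v => GLval a^-1%g *m v) _ => v.
by rewrite mulmxA -GL_MxE mulVg GL_1E mul1mx.
Qed.

Lemma u_inj : injective u.
Proof.
move=> i j uij; apply/val_inj.
have := congr1 (fun v : V2 => (v 0 0 == 1, v 1 0 == 1)) uij.
by rewrite !uE; case: i j {uij} => [[|[|[|?]]] ?] [[|[|[|?]]] ?].
Qed.

Lemma GL2_neq0 (a : GL2) : GLval a != 0.
Proof.
apply/eqP=> a0; have [j] := GL2_u a 0.
by rewrite a0 mul0mx => /esym/eqP; rewrite (negPf (u_neq0 j)).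
Qed.

(** With a u_0 = u_i, the vector a u_1 is one of the two others: if it is
    zeta u_i then a commutes with zeta, and otherwise a reverses the cyclic order of
    the u_i, so a zeta = zeta^2 a = (zeta + 1) a. *)
Lemma twist (a : GL2) :
  GLval a *m zeta_mx = zeta_mx *m GLval a + tw a *: GLval a.
Proof.
have [[i ui] [j uj]] := (GL2_u a 0, GL2_u a (rot 0)).
have a2 : GLval a *m u (rot (rot 0)) = u i + u j by rewrite -u_sum mulmxDr ui uj.
have nij : j != i.
  by apply/eqP=> eqij; move: uj; rewrite eqij -ui => /GL2_u_inj/u_inj.
have [jE|jE] : j = rot i \/ j = rot (rot i).
  move: nij; case: i {ui a2} => [[|[|[|?]]] ?]; case: j {uj} => [[|[|[|?]]] ?] //= _;
  by [left; apply/val_inj|right; apply/val_inj].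
- have az : GLval a *m zeta_mx = zeta_mx *m GLval a.
    apply: (@mx2_inj _ _ 0); rewrite -!mulmxA !zeta_u ?ui ?uj ?a2 !zeta_u jE //.
    by rewrite u_sum.
  by rewrite /tw GL2_index2 az eqxx scale0r addr0.
have az : GLval a *m zeta_mx = zeta_mx *m GLval a + GLval a.
  apply: (@mx2_inj _ _ 0); rewrite mulmxDl -!mulmxA !zeta_u ?ui ?uj ?a2 !zeta_u jE.
    by rewrite addrC u_sum.
  by rewrite rot3.
rewrite /tw GL2_index2 az -subr_eq0 addrAC subrr add0r.
by rewrite GL2_neq0 scale1r.
Qed.

Lemma tw1 : tw 1%g = 0.
Proof. by rewrite /tw GL2_index2 GL_1E mulmx1 mul1mx eqxx. Qed.

(** Apply [twist] to a b in two ways. *)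
Lemma twM a b : tw (a * b)%g = tw a + tw b.
Proof.
have := twist (a * b)%g; rewrite GL_MxE -mulmxA twist mulmxDr mulmxA twist.
rewrite mulmxDl -scalemxAr -scalemxAl mulmxA -addrA -scalerDl => /addrI/eqP.
rewrite -subr_eq0 -scalerBl scaler_eq0 -GL_MxE (negPf (GL2_neq0 _)) orbF.
by rewrite subr_eq0 => /eqP.
Qed.

Lemma odd_F2 n : n%:R = (odd n)%:R :> 'F_2.
Proof.
elim: n => //= n IHn; rewrite -natr1 IHn.
by case: (odd n); apply/eqP.
Qed.

Lemma N0P (g : GL8) : reflect
  (exists a : {ffun 'I_3 -> GL2}, is_tensor g a /\ \sum_m tw (a m) = 0) (g \in N0).
Proof.
have parity (a : 'I_3 -> GL2) :
    ~~ odd #|[set m | a m \notin index2]| = (\sum_m tw (a m) == 0).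
  rewrite -natr_sum odd_F2 -sum1dep_card [in LHS]big_mkcond /=.
  under [in LHS]eq_bigr do rewrite -[if _ then _ else _]/(nat_of_bool _).
  by case: (odd _).
rewrite inE; apply: (iffP existsP) => [[a /andP[ga]]|[a [ga /eqP a0]]].
  by rewrite parity => /eqP a0; exists a.
by exists a; rewrite ga parity.
Qed.

Lemma N0_group_set : group_set N0.
Proof.
apply/group_setP; split=> [|g h /N0P[a [/is_tensorP ga a0]] /N0P[b [/is_tensorP hb b0]]].
  apply/N0P; exists [ffun=> 1%g]; split.
    apply/is_tensorP=> x; rewrite ap1; apply: tensor_ext => m.
    by rewrite ffunE GL_1E mul1mx.
  by apply: big1 => m _; rewrite ffunE tw1.
apply/N0P; exists [ffun m => a m * b m]%g; split.
  apply/is_tensorP=> x; rewrite apM hb ga; apply: tensor_ext => m.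
  by rewrite ffunE GL_MxE mulmxA.
by under eq_bigr do rewrite ffunE twM; rewrite big_split /= a0 b0 addr0.
Qed.

Lemma factor_permsP (g : GL8) : reflect
  (exists s : 'S_3, forall x, ap g (tensor x) = tensor (x \o s)) (g \in factor_perms).
Proof.
rewrite inE; apply: (iffP existsP) => [[s /forallP gs]|[s gs]]; exists s.
  move=> x; have := gs (finfun x); rewrite (@tensor_ext (finfun x) x) => [/eqP->|m].
    by apply: tensor_ext => m; rewrite ffunE.
  by rewrite ffunE.
by apply/forallP=> x; rewrite gs.
Qed.

Lemma factor_perms_group_set : group_set factor_perms.
Proof.
apply/group_setP; split=> [|g h /factor_permsP[s gs] /factor_permsP[r hr]].
  apply/factor_permsP; exists 1%g => x; rewrite ap1.
  by apply: tensor_ext => m /=; rewrite perm1.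
apply/factor_permsP; exists (s * r)%g => x; rewrite apM hr gs.
by apply: tensor_ext => m /=; rewrite permM.
Qed.

Canonical N0_group := Group N0_group_set.
Canonical factor_perms_group := Group factor_perms_group_set.

Lemma factor_permsV_N0 (g f : GL8) :
  f \in factor_perms -> g \in N0 -> (f^-1 * (g * f))%g \in N0.
Proof.
move=> /factor_permsP[s fs] /N0P[a [/is_tensorP ga a0]].
apply/N0P; exists [ffun m => a (s^-1 m)]%g; split.
  apply/is_tensorP=> x; rewrite 2!apM fs ga.
  apply: (@ap_inj f); rewrite apVK fs; apply: tensor_ext => m /=.
  by rewrite ffunE permK.
rewrite -[RHS]a0 [RHS](reindex_inj (@perm_inj _ s^-1%g)) /=.
by apply: eq_bigr => m _; rewrite ffunE.
Qed.

Lemma G0_group_set : group_set G0_segre.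
Proof.
apply/(@comm_group_setP _ N0_group factor_perms_group)/esym/normC.
apply/subsetP=> f Ff; rewrite inE; apply/subsetP=> _ /imsetP[g Ng ->].
exact: factor_permsV_N0.
Qed.

Canonical G0_group := Group G0_group_set.

(** * W as a sum of three rotations *)

Lemma code_sum3 (F : 'I_3 -> V8) (f : nat -> num) :
  (forall m : 'I_3, code (F m) = f m) ->
  code (\sum_m F m) = lxor (f 0%N) (lxor (f 1%N) (f 2%N)).
Proof.
move=> Ff; rewrite !big_ord_recl big_ord0 addr0 !codeD !Ff.
by [].
Qed.

Lemma tseq_upd t m c : tseq (upd t m c) = set_nth 0%N (tseq t) m c.
Proof.
apply: (@eq_from_nth _ 0%N).
  by rewrite size_set_nth !size_tseq (maxn_idPr (ltn_ord m)).
move=> i; rewrite size_tseq => lti.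
rewrite nth_set_nth /= -[i]/(nat_of_ord (Ordinal lti)) !nth_tseq /upd.
by rewrite (inj_eq val_inj); case: eqP.
Qed.

(** The sum over m of E_t with its m-th index increased modulo 3. *)
Definition W_code (t : seq nat) : num :=
  let turn m := codeE (set_nth 0%N t m ((nth 0%N t m).+1 %% 3)%N) in
  lxor (turn 0%N) (lxor (turn 1%N) (turn 2%N)).

Definition W_cols : seq num := [seq W_code b | b <- basis].

Lemma code_W v : code (ap W v) = mulc W_cols (code v).
Proof.
apply: code_mulmx => j ltj; rewrite [GLval W]/(images_mx W_images) images_mx_e //.
by do 8?[case: j ltj => [|j] ltj //]; rewrite /W_images /= !codeD !code_e //.
Qed.

Lemma all_triplesP (P : pred (seq nat)) : all P triples -> forall t, P (tseq t).
Proof. by move/allP=> allPt t; apply: allPt; apply: tseq_triples. Qed.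

Lemma W_E t : ap W (E t) = \sum_m E (upd t m (rot (t m))).
Proof.
apply: code_inj.
pose f m := codeE (set_nth 0%N (tseq t) m ((nth 0%N (tseq t) m).+1 %% 3)%N).
rewrite (@code_sum3 _ f) => [|m]; last first.
  rewrite code_E tseq_upd /f nth_tseq; congr (codeE (set_nth _ _ _ _)).
  by case: (t m) => [[|[|[|?]]] ?].
have := @all_triplesP (fun t => mulc W_cols (codeE t) == W_code t) isT t.
by rewrite code_W code_E => /eqP.
Qed.

(** This is W = zeta_1 + zeta_2 + zeta_3. *)
Lemma W_tensor x : ap W (tensor x) = \sum_m tensor (upd x m (zeta_mx *m x m)).
Proof.
have [[m xm0]|[t xE]] := tensor_cases x.
  rewrite (tensor_eq0 xm0) mulmx0 big1 // => k _; apply: (@tensor_eq0 _ m).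
  by rewrite /upd; have [<-|//] := eqVneq m k; rewrite xm0 mulmx0.
rewrite (tensor_ext xE) -[tensor _]/(E t) W_E; apply: eq_bigr => m _.
apply: tensor_ext => k; rewrite /upd.
by case: eqP => _; rewrite xE //= zeta_u.
Qed.

Lemma W_E_comm (g : GL8) : (forall x, ap g (ap W (tensor x)) = ap W (ap g (tensor x))) ->
  (g * W = W * g)%g.
Proof. by move=> gW; apply: GL8_E_inj => t; rewrite !apM gW. Qed.

Lemma tensor_updZ x m (c : 'F_2) v : tensor (upd x m (c *: v)) = c *: tensor (upd x m v).
Proof.
apply/colP=> r; rewrite !mxE !(bigD1 (P := predT) m) //= /upd eqxx mxE mulrA.
by congr (_ * _ * _); apply: eq_bigr => k /negPf->.
Qed.

(** Moving g past the m-th rotation costs tw (a m) times g itself, and the total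
    cost is 0 because an even number of the a m lie outside H. *)
Lemma W_N0 (g : GL8) : g \in N0 -> (g * W = W * g)%g.
Proof.
case/N0P=> a [/is_tensorP ga a0]; apply: W_E_comm => x.
pose y m := GLval (a m) *m x m.
have yE m v : tensor (fun k => GLval (a k) *m upd x m v k)
    = tensor (upd y m (GLval (a m) *m v)).
  by apply: tensor_ext => k; rewrite /upd; case: eqP => [->|].
rewrite W_tensor ga W_tensor mulmx_sumr.
transitivity (\sum_m (tensor (upd y m (zeta_mx *m y m)) + tw (a m) *: tensor y)).
  apply: eq_bigr => m _; rewrite ga yE mulmxA twist mulmxDl -mulmxA -scalemxAl.
  rewrite tensor_updD tensor_updZ; congr (_ + _ *: _); apply: tensor_ext => k.
  by rewrite /upd; case: eqP => [->|].
by rewrite big_split /= -scaler_suml a0 scale0r addr0.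
Qed.

(** A permutation of the factors permutes the three rotations. *)
Lemma W_factor_perms (f : GL8) : f \in factor_perms -> (f * W = W * f)%g.
Proof.
case/factor_permsP=> s fs; apply: W_E_comm => x.
rewrite fs !W_tensor mulmx_sumr [LHS](reindex_inj (@perm_inj _ s)) /=.
apply: eq_bigr => m _; rewrite fs; apply: tensor_ext => k /=.
by rewrite /upd (inj_eq perm_inj).
Qed.

Lemma W_G0 (g : GL8) : g \in G0_segre -> (g * W = W * g)%g.
Proof.
case/imset2P=> n f /W_N0 nW /W_factor_perms fW ->.
by rewrite -mulgA fW mulgA nW mulgA.
Qed.

Definition J_cols : seq num := [seq codeE b | b <- rev basis].

Lemma code_J v : code (ap J v) = mulc J_cols (code v).
Proof.
apply: code_mulmx => j ltj; rewrite [GLval J]/(images_mx J_images) images_mx_e //.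
by do 8?[case: j ltj => [|j] ltj //]; rewrite /J_images /= code_e.
Qed.

Lemma J_E t : ap J (E t) = E (fun m => 1 - t m).
Proof.
apply: code_inj; rewrite code_J !code_E.
have -> : tseq (fun m => 1 - t m) = [seq (4 - i) %% 3 | i <- tseq t]%N.
  rewrite -map_comp; apply: eq_map => m /=.
  by case: (t m) => [[|[|[|?]]] ?].
apply/eqP/(@all_triplesP (fun t =>
  mulc J_cols (codeE t) == codeE [seq (4 - i) %% 3 | i <- t]%N)).
by vm_compute.
Qed.

(** * Distinguished tangents *)

Definition codes : seq num := [seq of_nat i | i <- iota 0 256].

Lemma code_codes v : code v \in codes.
Proof.
rewrite /code !enum_ordSl enum_ord0 /=; do 8!case: (_ == 1 :> 'F_2); by vm_compute.
Qed.

Lemma all_codesP (P : pred num) : all P codes -> forall v, P (code v).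
Proof. by move/allP=> allPn v; apply: allPn; apply: code_codes. Qed.

Definition S_codes : seq num := [seq codeE t | t <- triples].

Lemma E_inj (t t' : 'I_3 -> 'I_3) : E t = E t' -> t =1 t'.
Proof.
move=> eqE m; apply: val_inj; rewrite /= -(nth_tseq t) -(nth_tseq t').
have chk : all (fun r =>
    all (fun s => (codeE r == codeE s) ==> (r == s)) triples) triples.
  by vm_compute.
have := all_triplesP (@all_triplesP (fun r => all _ triples) chk t) t'.
by rewrite -!code_E eqE eqxx => /eqP->.
Qed.

Lemma ETP (t : 'I_3 -> 'I_3) : exists t' : triple, E t = E t'.
Proof. by exists (finfun t); apply: tensor_ext => m; rewrite ffunE. Qed.

Lemma E_segre t : E t \in segre.
Proof. by have [t' ->] := ETP t; apply: imset_f. Qed.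

Lemma segre_code v : (v \in segre) = (code v \in S_codes).
Proof.
apply/imsetP/mapP => [[t _ ->]|[t tP vt]].
  by exists (tseq t); rewrite ?tseq_triples ?code_E.
by exists (pt t) => //; apply: code_inj; rewrite code_E tseq_pt.
Qed.

(** All subset sums: over GF(2) these are all linear combinations. *)
Fixpoint span_codes (l : seq num) : seq num :=
  if l is a :: l' then let s := span_codes l' in s ++ [seq lxor a n | n <- s]
  else [:: BinNums.N0].

Lemma F2_scale (c : 'F_2) (v : V8) : c *: v = 0 \/ c *: v = v.
Proof. by rewrite [c]F2P; case: (c == 1); rewrite ?scale1r ?scale0r; [right|left]. Qed.

Lemma V8_addvv (v : V8) : v + v = 0.
Proof. by apply: code_inj; rewrite codeD BinNat.N.lxor_nilpotent code0. Qed.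

Lemma span_code (X : seq V8) v :
  (v \in <<X>>%VS) = (code v \in span_codes [seq code x | x <- X]).
Proof.
elim: X v => [|a X IHX] v; first by rewrite span_nil memv0 inE code_eq0.
rewrite span_cons /= mem_cat -IHX; apply/memv_addP/orP.
  case=> w /vlineP[c ->] [w' Xw' ->]; have [->|->] := F2_scale c a.
    by left; rewrite add0r.
  by right; rewrite codeD map_f // -IHX.
case=> [Xv|/mapP[n Xn vE]].
  by exists 0; rewrite ?mem0v //; exists v; rewrite ?add0r.
exists a; first exact: memv_line.
exists (a + v); last by rewrite addrA V8_addvv add0r.
by rewrite IHX codeD vE -BinNat.N.lxor_assoc BinNat.N.lxor_nilpotent BinNat.N.lxor_0_l.
Qed.

Lemma pspan_code (A : {set V8}) (X : seq V8) v : A =i X ->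
  (v \in pspan A) = (v != 0) && (code v \in span_codes [seq code x | x <- X]).
Proof.
move=> AX; rewrite !inE -span_code; suff -> : <<enum A>>%VS = <<X>>%VS by [].
by apply: eq_span => x; rewrite mem_enum; apply: AX.
Qed.

Definition line (m : 'I_3) (t : triple) : {set V8} :=
  [set E t' | t' : triple & [forall l, (l != m) ==> (t' l == t l)]].

Definition line_seq (m : 'I_3) (t : triple) : seq V8 :=
  [seq E (upd t m c) | c <- enum 'I_3].

Lemma line_seqP m (t : triple) : line m t =i line_seq m t.
Proof.
move=> v; apply/imsetP/mapP => [[t']|[c _ ->]].
  rewrite inE => /forallP t't ->; exists (t' m); rewrite ?mem_enum //.
  apply: tensor_ext => l; rewrite /upd; have [->//|nlm] := eqVneq l m.
  by have := t't l; rewrite nlm => /eqP->.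
exists (finfun (upd t m c)); last by apply: tensor_ext => l; rewrite ffunE.
by rewrite inE; apply/forallP=> l; apply/implyP=> /negPf nlm; rewrite ffunE /upd nlm.
Qed.

Lemma mem_line m (t : triple) c : E (upd t m c) \in line m t.
Proof. by rewrite line_seqP map_f ?mem_enum. Qed.

Lemma E_line m (t : triple) : E t \in line m t.
Proof.
rewrite (_ : E t = E (upd t m (t m))) ?mem_line //; apply: tensor_ext => l.
by rewrite /upd; case: eqP => [->|].
Qed.

Lemma line_inj m m' (t : triple) : line m t = line m' t -> m = m'.
Proof.
move=> eq_mm'; apply/eqP; have [//|nmm'] := eqVneq m m'.
have : E (upd t m (rot (t m))) \in line m' t by rewrite -eq_mm' mem_line.
rewrite line_seqP => /mapP[c _ /E_inj/(_ m)]; rewrite /upd eqxx (negPf nmm') => /eqP.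
by case: (t m) => [[|[|[|?]]] ?].
Qed.

(** A generator through E_t is obtained by letting one index of t vary. *)
Lemma generators_atP (t : triple) l :
  reflect (exists m, l = line m t) (l \in generators_at (E t)).
Proof.
rewrite inE; apply: (iffP andP) => [[/imset2P[m t0 _ _ ->]]|[m ->]]; last first.
  by split; [apply: imset2_f | apply: E_line].
rewrite -/(line m t0) => /imsetP[t1]; rewrite inE => /forallP t1t0 /E_inj tt1.
exists m; apply/setP=> v; apply/imsetP/imsetP => -[t']; rewrite inE => /forallP t't ->;
  exists t' => //; rewrite inE; apply/forallP=> i; apply/implyP=> ni.
  by have /implyP/(_ ni)/eqP-> := t't i; have /implyP/(_ ni)/eqP <- := t1t0 i; rewrite tt1.
by have /implyP/(_ ni)/eqP-> := t't i; have /implyP/(_ ni)/eqP <- := t1t0 i; rewrite tt1.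
Qed.

Definition line_codes (t : seq nat) (m : nat) : seq num :=
  [seq codeE (set_nth 0%N t m c) | c <- iota 0 3].

Lemma code_line_seq m t : [seq code v | v <- line_seq m t] = line_codes (tseq t) m.
Proof.
rewrite -map_comp /line_codes -val_enum_ord -map_comp; apply: eq_map => c /=.
by rewrite code_E tseq_upd.
Qed.

Definition Z_codes t : seq num :=
  span_codes (flatten [seq line_codes t m | m <- iota 0 3]).

(** The three planes through a point, each listed for both orders of its two
    generators. *)
Definition plane_codes t : seq (seq num) :=
  [seq span_codes (line_codes t mm.1 ++ line_codes t mm.2)
     | mm <- [:: (0, 1); (0, 2); (1, 0); (1, 2); (2, 0); (2, 1)]%N].

Definition tangent_codes (p : num) : seq num :=
  [:: p; mulc W_cols p; mulc W_cols (mulc W_cols p)].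

Lemma Z_code (t : triple) v : (v \in Z (E t)) = (v != 0) && (code v \in Z_codes (tseq t)).
Proof.
rewrite (@pspan_code _ (flatten [seq line_seq m t | m <- enum 'I_3])) => [|w]; last first.
  apply/bigcupP/flatten_mapP => [[l /generators_atP[m ->]]|[m _ mw]].
    by rewrite line_seqP => mw; exists m; rewrite ?mem_enum.
  by exists (line m t); rewrite ?line_seqP //; apply/generators_atP; exists m.
rewrite map_flatten -map_comp /Z_codes -val_enum_ord -map_comp.
by congr (_ && (_ \in span_codes (flatten _))); apply: eq_map => m; apply: code_line_seq.
Qed.

Lemma plane_code (t : triple) v : (v \in cover (planes_at (E t)))
  = (v != 0) && has (fun s => code v \in s) (plane_codes (tseq t)).
Proof.
have planeE m m' : (v \in pspan (line m t :|: line m' t)) = (v != 0) &&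
    (code v \in span_codes (line_codes (tseq t) m ++ line_codes (tseq t) m')).
  rewrite (@pspan_code _ (line_seq m t ++ line_seq m' t)) => [|w].
    by rewrite map_cat !code_line_seq.
  by rewrite inE mem_cat !line_seqP.
apply/bigcupP/andP => [[_ /imset2P[l l' gl gl' ->]]|].
  move: gl'; rewrite inE; case/generators_atP: gl => m -> /andP[].
  case/generators_atP=> m' -> nl.
  rewrite planeE => /andP[-> vm]; split=> //; apply/hasP.
  exists (span_codes (line_codes (tseq t) m ++ line_codes (tseq t) m')) => //.
  apply/mapP; exists (val m, val m') => //.
  have : m != m' by apply: contraNneq nl => ->.
  by case: m m' {vm nl} => [[|[|[|?]]] ?] [[|[|[|?]]] ?].
case=> nz /hasP[s /mapP[[m m'] mm' ->]] vs.
have [ltm ltm' nmm'] : [/\ m < 3, m' < 3 & m != m']%N.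
  have /allP h : all (fun mm : nat * nat => [&& mm.1 < 3, mm.2 < 3 & mm.1 != mm.2])%N
      [:: (0, 1); (0, 2); (1, 0); (1, 2); (2, 0); (2, 1)]%N by [].
  exact/and3P/(h _ mm').
exists (pspan (line (Ordinal ltm) t :|: line (Ordinal ltm') t)).
  apply/imset2P; exists (line (Ordinal ltm) t) (line (Ordinal ltm') t) => //.
    by apply/generators_atP; exists (Ordinal ltm).
  rewrite inE; apply/andP; split; first by apply/generators_atP; exists (Ordinal ltm').
  by apply: contra_neq nmm' => /line_inj/(congr1 val).
by rewrite planeE nz.
Qed.

(** Membership in the tangent at E_t as it is defined: outside the planes and
    inside the 3-flat, or equal to the point. *)
Definition tangent_test (t : seq nat) (n : num) : bool :=
  let nz := n != BinNums.N0 in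
  (n == codeE t)
    || ~~ (nz && has (fun s => n \in s) (plane_codes t)) && (nz && (n \in Z_codes t)).

Lemma tangent_code (t : triple) v :
  (v \in tangent (E t)) = tangent_test (tseq t) (code v).
Proof.
rewrite /tangent in_setU1 in_setD Z_code plane_code.
by rewrite -(inj_eq code_inj) code_E /tangent_test code_eq0.
Qed.

Lemma tangent_test_codes : all (fun t => all (fun n =>
  tangent_test t n == (n \in tangent_codes (codeE t))) codes) triples.
Proof. by vm_compute. Qed.

(** In the 3-flat Z(p) = <p, n_1, n_2, n_3>, with n_m on the m-th generator, a point
    outside the three planes involves all of n_1, n_2, n_3, so it is
    n_1 + n_2 + n_3 or p + n_1 + n_2 + n_3; these are W p and W^2 p. *)
Lemma tangentE (t : triple) : tangent (E t) = [set E t; ap W (E t); ap W (ap W (E t))].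
Proof.
apply/setP=> v; rewrite tangent_code.
have /eqP-> := all_codesP (all_triplesP tangent_test_codes t) v.
rewrite !in_setU !in_set1 -!(inj_eq code_inj) !code_W code_E.
by rewrite /tangent_codes !in_cons in_nil orbF orbA.
Qed.

(** * The stabiliser of S normalises <W> *)

Lemma W_W_W v : ap W (ap W (ap W v)) = v.
Proof.
by have := congr1 (fun A => A *m v) W_cubed; rewrite mul1mx -!mulmxA.
Qed.

Lemma W_codes_notin : all (fun t =>
  (mulc W_cols (codeE t) \notin S_codes)
  && (mulc W_cols (mulc W_cols (codeE t)) \notin S_codes)) triples.
Proof. by vm_compute. Qed.

Lemma W_notin v : v \in segre -> ap W v \notin segre.
Proof.
case/imsetP=> t _ ->; rewrite segre_code code_W code_E.
by have /andP[] := all_triplesP W_codes_notin t.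
Qed.

Lemma W_no_fix v : v \in segre -> ap W v <> v.
Proof. by move=> Sv Wv; have := W_notin Sv; rewrite Wv Sv. Qed.

Lemma W_W_notin v : v \in segre -> ap W (ap W v) \notin segre.
Proof.
case/imsetP=> t _ ->; rewrite segre_code !code_W code_E.
by have /andP[] := all_triplesP W_codes_notin t.
Qed.

(** The points a, b, c lie on the three generators through p, one on each.  The
    condition only uses sums and S, so the stabiliser of S preserves it: this is how
    a map that stabilises S is seen to preserve tangents. *)
Definition tripod (p a b c : V8) : bool :=
  all (fun v => v \in segre) [:: p; a; b; c; p + a; p + b; p + c]
  && all (fun v => (v != 0) && (v \notin segre)) [:: a + b; a + c; b + c].

Definition tripod_codes (p a b c : num) : bool :=
  all (fun n => n \in S_codes) [:: p; a; b; c; lxor p a; lxor p b; lxor p c]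
  && all (fun n => (n != BinNums.N0) && (n \notin S_codes))
       [:: lxor a b; lxor a c; lxor b c].

Lemma tripod_code p a b c :
  tripod p a b c = tripod_codes (code p) (code a) (code b) (code c).
Proof. by rewrite /tripod /tripod_codes /= !segre_code -!code_eq0 !codeD. Qed.

Definition neighbours (p : num) : seq num :=
  [seq a <- S_codes | lxor p a \in S_codes].

(** Up to order there are eight choices of a, b, c at each p, but only two sums. *)
Lemma tripod_sum_codes : all (fun p => all (fun a => all (fun b => all (fun c =>
    tripod_codes p a b c ==> (lxor a (lxor b c) \in behead (tangent_codes p)))
  (neighbours p)) (neighbours p)) (neighbours p)) S_codes.
Proof. by vm_compute. Qed.

Lemma tripod_sum p a b c : tripod p a b c ->
  a + (b + c) = ap W p \/ a + (b + c) = ap W (ap W p).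
Proof.
move=> trip; have /allP/(_ (code p)) := tripod_sum_codes.
have := trip; rewrite tripod_code => /andP[].
move=> /and5P[pS aS bS cS /and3P[paS pbS /andP[pcS _]]] _.
have nb n : n \in S_codes -> lxor (code p) n \in S_codes -> n \in neighbours (code p).
  by rewrite mem_filter => -> ->.
move=> /(_ pS)/allP/(_ _ (nb _ aS paS))/allP/(_ _ (nb _ bS pbS))/allP/(_ _ (nb _ cS pcS)).
rewrite -tripod_code trip -!codeD /tangent_codes -!code_W /=.
rewrite in_cons mem_seq1 !(inj_eq code_inj).
by case/orP=> /eqP; [left | right].
Qed.

Lemma W_tripod_codes : all (fun t =>
  let a m := codeE (set_nth 0%N t m ((nth 0%N t m).+1 %% 3)%N) in
  tripod_codes (codeE t) (a 0%N) (a 1%N) (a 2%N)) triples.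
Proof. by vm_compute. Qed.

Lemma rot_val i : rot i = (i.+1 %% 3)%N :> nat.
Proof. by case: i => [[|[|[|?]]] ?]. Qed.

(** W p = zeta_1 p + zeta_2 p + zeta_3 p is such a sum. *)
Lemma W_tripod t : exists a b c, tripod (E t) a b c /\ ap W (E t) = a + (b + c).
Proof.
pose a m := E (upd t m (rot (t m))).
have aE m : code (a m) = codeE (set_nth 0%N (tseq t) m ((nth 0%N (tseq t) m).+1 %% 3)%N).
  by rewrite code_E tseq_upd nth_tseq rot_val.
exists (a ord0), (a (lift ord0 ord0)), (a (lift ord0 (lift ord0 ord0))); split.
  rewrite tripod_code !aE code_E; exact: (all_triplesP W_tripod_codes t).
by rewrite W_E !big_ord_recl big_ord0 addr0.
Qed.

Lemma stab_tripod (g : GL8) p a b c : g \in stab segre ->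
  tripod p a b c -> tripod (ap g p) (ap g a) (ap g b) (ap g c).
Proof.
move=> /stabP gS; have gSE v : (ap g v \in segre) = (v \in segre).
  by rewrite -{1}gS ap_im.
have g0 v : (ap g v != 0) = (v != 0).
  by rewrite -{1}(mulmx0 _ (GLval g)) (inj_eq (@ap_inj g)).
have all_g P l : (forall v, P (ap g v) = P v) -> all P [seq ap g v | v <- l] = all P l.
  by move=> gP; rewrite all_map; apply: eq_all => v; apply: gP.
rewrite /tripod -(all_g _ _ gSE).
rewrite -(all_g (fun v => (v != 0) && (v \notin segre))) => [|v]; last by rewrite g0 gSE.
by rewrite /= !mulmxDr.
Qed.

Lemma stab_W_E (g : GL8) t : g \in stab segre ->
  ap g (ap W (E t)) = ap W (ap g (E t))
  \/ ap g (ap W (E t)) = ap W (ap W (ap g (E t))).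
Proof.
move=> gS; have [a [b [c [trip ->]]]] := W_tripod t.
by have := tripod_sum (stab_tripod gS trip); rewrite -!mulmxDr.
Qed.

(** The third point of a generator. *)
Lemma E_sum t m : E (upd t m (rot (rot (t m)))) = E t + E (upd t m (rot (t m))).
Proof.
have updE c : E (upd t m c) = tensor (upd (u \o t) m (u c)).
  by apply: tensor_ext => k; rewrite /upd; case: eqP.
have -> : E t = E (upd t m (t m)).
  by apply: tensor_ext => k; rewrite /upd; case: eqP => [->|].
by rewrite !updE -tensor_updD u_sum.
Qed.

Section Normaliser.
Context (g : GL8) (gS : g \in stab segre).
Let comm t := ap g (ap W (E t)) = ap W (ap g (E t)).

(** For p, q on a generator, the value of g W at the third point p + q leaves no
    room for different choices at p and q, because W fixes no point of S. *)
Lemma comm_turn t m : comm t -> comm (upd t m (rot (t m))).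
Proof.
pose q := upd t m (rot (t m)); rewrite -/q => tC.
have gE s : ap g (E s) \in segre by rewrite -(stabP _ _ gS) ap_im E_segre.
have [//|qN] := stab_W_E q gS; have := stab_W_E (upd t m (rot (rot (t m)))) gS.
rewrite E_sum -/q !mulmxDr tC qN => -[/addrI | /addIr].
  by move/(@ap_inj W); case/W_no_fix.
by move/(@ap_inj W)/esym; case/W_no_fix.
Qed.

Lemma comm_ext t t' : t =1 t' -> comm t -> comm t'.
Proof.
move=> tt'; rewrite /comm; suff -> : E t = E t' by [].
by apply: tensor_ext => m; rewrite tt'.
Qed.

Lemma comm_upd t m c : comm t -> comm (upd t m c).
Proof.
move=> tC; have : [|| c == t m, c == rot (t m) | c == rot (rot (t m))].
  by case: c (t m) => [[|[|[|?]]] ?] [[|[|[|?]]] ?].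
case/or3P=> /eqP->.
- by apply: comm_ext tC => k; rewrite /upd; case: eqP => [->|].
- exact: comm_turn.
apply: comm_ext (comm_turn m (comm_turn m tC)) => k.
by rewrite /upd; case: eqP => // _; rewrite eqxx.
Qed.

(** Change one index at a time. *)
Lemma comm_all t t' : comm t -> comm t'.
Proof.
pose i1 : 'I_3 := lift ord0 ord0; pose i2 : 'I_3 := lift ord0 (lift ord0 ord0).
move/(comm_upd ord0 (t' ord0))/(comm_upd i1 (t' i1))/(comm_upd i2 (t' i2)).
apply: comm_ext => k; rewrite /upd; case: eqP => [-> //|n2].
case: eqP => [-> //|n1]; case: eqP => [-> //|n0].
by case: k n0 n1 n2 => [[|[|[|?]]] ?] //= n0 n1 n2;
  [case: n0 | case: n1 | case: n2]; apply: val_inj.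
Qed.

Lemma stab_normalises_W : (g * W = W * g)%g \/ (g * W = W * W * g)%g.
Proof.
pose t0 : triple := [ffun=> 0]; have [t0C|t0N] := stab_W_E t0 gS.
  by left; apply: GL8_E_inj => t; rewrite !apM; apply: comm_all t0C.
right; apply: GL8_E_inj => t; rewrite !apM.
have [tC|//] := stab_W_E t gS.
have Sg : ap g (E t) \in segre by rewrite -(stabP _ _ gS) ap_im E_segre.
have := comm_all t0 tC; rewrite /comm t0N => /(@ap_inj W) W_fix.
have Sg0 : ap g (E t0) \in segre by rewrite -(stabP _ _ gS) ap_im E_segre.
by case: (W_no_fix Sg0).
Qed.
End Normaliser.

(** * Four elements of G^0 *)

Definition cols (phi : seq nat -> seq nat) : seq num := [seq codeE (phi b) | b <- basis].

(** The map phi of indices extends to the linear map with columns [cols phi], and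
    psi inverts it. *)
Definition linear_on_triples (phi psi : seq nat -> seq nat) : bool :=
  all (fun t => [&& phi t \in triples, mulc (cols phi) (codeE t) == codeE (phi t)
                  & psi (phi t) == t]) triples.

Definition images_E (phi : seq nat -> seq nat) : 'M['F_2]_8 :=
  images_mx [seq E (pt (phi b)) | b <- basis].

Lemma code_images_E phi psi v : linear_on_triples phi psi ->
  code (images_E phi *m v) = mulc (cols phi) (code v).
Proof.
move=> /allP lin; apply: code_mulmx => j ltj; rewrite images_mx_e //.
rewrite (nth_map [::]) // [RHS](nth_map [::]) // code_E tseq_pt //.
suff /lin/and3P[] : nth [::] basis j \in triples by [].
have /allP := isT : all (fun b => b \in triples) basis; apply; exact: mem_nth.
Qed.

Lemma gen_exists phi psi : linear_on_triples phi psi -> linear_on_triples psi phi ->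
  exists g : GL8, (forall t, ap g (E t) = E (pt (phi (tseq t))))
    /\ (forall v, code (ap g v) = mulc (cols phi) (code v)).
Proof.
move=> lin_phi lin_psi.
have imE phi1 psi1 t : linear_on_triples phi1 psi1 ->
    images_E phi1 *m E t = E (pt (phi1 (tseq t))).
  move=> lin1; apply: code_inj; rewrite (code_images_E _ lin1) !code_E.
  by have /and3P[phit /eqP-> _] := all_triplesP lin1 t; rewrite tseq_pt.
have phi_unit : images_E phi \is a GRing.unit.
  suff /mulmx1_unit[] : images_E psi *m images_E phi = 1%:M by [].
  apply: mx_E_inj => t; rewrite -mulmxA (imE _ _ _ lin_phi) (imE _ _ _ lin_psi) mul1mx.
  have /and3P[phit _ /eqP psit] := all_triplesP lin_phi t.
  by apply: code_inj; rewrite !code_E (tseq_pt phit) psit tseq_pt ?tseq_triples.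
exists (Sub (images_E phi) phi_unit); split=> [t | v]; first exact: imE lin_phi.
exact: code_images_E lin_phi.
Qed.

Lemma is_tensor_E (g : GL8) (a : {ffun 'I_3 -> GL2}) :
  (forall t : triple, ap g (E t) = tensor (fun m => GLval (a m) *m u (t m))) ->
  is_tensor g a.
Proof.
move=> ga; apply/is_tensorP=> x; have [[m xm0]|[t xE]] := tensor_cases x.
  by rewrite (tensor_eq0 xm0) mulmx0 (@tensor_eq0 _ m) // xm0 mulmx0.
by rewrite (tensor_ext xE) -[tensor _]/(E t) ga; apply: tensor_ext => m; rewrite xE.
Qed.

Lemma factor_perm_E (g : GL8) (s : 'S_3) :
  (forall t : triple, ap g (E t) = E (t \o s)) -> g \in factor_perms.
Proof.
move=> gs; apply/factor_permsP; exists s => x.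
have [[m xm0]|[t xE]] := tensor_cases x.
  by rewrite (tensor_eq0 xm0) mulmx0 (@tensor_eq0 _ ((s^-1)%g m)) //= permKV.
by rewrite (tensor_ext xE) -[tensor _]/(E t) gs; apply: tensor_ext => m; rewrite /= xE.
Qed.

Lemma N0_sub_G0 (g : GL8) : g \in N0 -> g \in G0_segre.
Proof. by move=> gN; apply: (subsetP (mulG_subl factor_perms_group N0)). Qed.

Lemma factor_perms_sub_G0 (g : GL8) : g \in factor_perms -> g \in G0_segre.
Proof. by move=> gF; apply: (subsetP (mulG_subr N0_group factor_perms)). Qed.

(** The index maps of zeta (x) 1 (x) 1, tau (x) tau (x) 1 and of the two
    transpositions of neighbouring factors. *)
Definition turn1 (t : seq nat) : seq nat :=
  [:: (nth 0%N t 0).+1 %% 3; nth 0%N t 1; nth 0%N t 2]%N.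
Definition flip12 (t : seq nat) : seq nat :=
  [:: (3 - nth 0%N t 0) %% 3; (3 - nth 0%N t 1) %% 3; nth 0%N t 2]%N.
Definition swap12 (t : seq nat) : seq nat := [:: nth 0%N t 1; nth 0%N t 0; nth 0%N t 2].
Definition swap23 (t : seq nat) : seq nat := [:: nth 0%N t 0; nth 0%N t 2; nth 0%N t 1].

Definition gens : seq (seq num) :=
  [seq cols phi | phi <- [:: turn1; flip12; swap12; swap23]].

Lemma val_opp3 (i : 'I_3) : - i = ((3 - i) %% 3)%N :> nat.
Proof. by case: i => [[|[|[|?]]] ?]. Qed.

Lemma tseq3 t : tseq t =
  [:: val (t ord0); val (t (lift ord0 ord0)); val (t (lift ord0 (lift ord0 ord0)))].
Proof. by rewrite /tseq !enum_ordSl enum_ord0. Qed.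

Lemma E_pt t s : tseq t = s -> E (pt s) = E t.
Proof. by move<-; apply: code_inj; rewrite !code_E tseq_pt ?tseq_triples. Qed.

Lemma zeta_index2 : zeta \in index2.
Proof. by rewrite GL2_index2. Qed.

Lemma tau_index2 : tau \notin index2.
Proof.
rewrite GL2_index2; apply/eqP=> /(congr1 (fun A => A *m u 0)); rewrite -!mulmxA.
by rewrite -[GLval tau]/tau_mx !(tau_u, zeta_u) => /u_inj.
Qed.

Lemma gens_G0 M : M \in gens ->
  exists2 g : GL8, g \in G0_segre & forall v, code (ap g v) = mulc M (code v).
Proof.
rewrite !inE => /or4P[] /eqP->.
- have lin : linear_on_triples turn1 (turn1 \o turn1)
    /\ linear_on_triples (turn1 \o turn1) turn1 by [].
  have [g [gE gM]] := gen_exists lin.1 lin.2.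
  exists g => //; apply: N0_sub_G0; apply/N0P.
  exists [ffun m : 'I_3 => if m == ord0 then zeta else 1%g]; split; last first.
    by rewrite !big_ord_recl big_ord0 !ffunE /= tw1 !addr0 /tw zeta_index2.
  apply: is_tensor_E => t; rewrite gE (@E_pt (upd t ord0 (rot (t ord0)))); last first.
    by rewrite tseq_upd rot_val tseq3.
  apply: tensor_ext => m; rewrite ffunE /upd; case: eqP => [->|_].
    by rewrite zeta_u.
  by rewrite GL_1E mul1mx.
- have lin : linear_on_triples flip12 (flip12) /\ linear_on_triples (flip12) flip12 by [].
  have [g [gE gM]] := gen_exists lin.1 lin.2.
  exists g => //; apply: N0_sub_G0; apply/N0P.
  exists [ffun m : 'I_3 => if m == ord_max then 1%g else tau]; split; last first.
    rewrite !big_ord_recl big_ord0 !ffunE /= tw1 !addr0 /tw tau_index2.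
    by apply/eqP.
  apply: is_tensor_E => t.
  rewrite gE (@E_pt (fun m => if m == ord_max then t m else - t m)); last first.
    by rewrite /flip12 !tseq3; congr [:: _; _; _]; apply: val_opp3.
  apply: tensor_ext => m; rewrite ffunE; case: eqP => [->|_].
    by rewrite GL_1E mul1mx.
  by rewrite tau_u.
- have lin : linear_on_triples swap12 (swap12) /\ linear_on_triples (swap12) swap12 by [].
  have [g [gE gM]] := gen_exists lin.1 lin.2.
  exists g => //; apply: factor_perms_sub_G0.
  apply: (@factor_perm_E _ (tperm ord0 (lift ord0 ord0))) => t; rewrite gE.
  by apply: E_pt; rewrite /swap12 !tseq3 /= ?tpermL ?tpermR ?tpermD.
have lin : linear_on_triples swap23 (swap23) /\ linear_on_triples (swap23) swap23 by [].
  have [g [gE gM]] := gen_exists lin.1 lin.2.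
exists g => //; apply: factor_perms_sub_G0.
apply: (@factor_perm_E _ (tperm (lift ord0 ord0) (lift ord0 (lift ord0 ord0)))) => t.
rewrite gE; by apply: E_pt; rewrite /swap23 !tseq3 /= ?tpermL ?tpermR ?tpermD.
Qed.

(** * Invariant sets and orbits of G^0 *)

Definition step (l : seq num) : seq num :=
  undup (l ++ flatten [seq [seq mulc M n | n <- l] | M <- gens]).

Definition reach (k : nat) (l : seq num) : seq num := iter k step l.

Lemma reachP k r n : n \in reach k [:: code r] ->
  exists2 g : GL8, g \in G0_segre & n = code (ap g r).
Proof.
have : {in [:: code r], forall n, exists2 g : GL8, g \in G0_segre & n = code (ap g r)}.
  move=> _ /[1!inE] /eqP->; exists 1%g; first exact: (group1 G0_group).
  by rewrite ap1.
elim: k n => [|k IHk] n lG; first exact: lG.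
rewrite /reach iterS -/(reach k _) mem_undup mem_cat => /orP[/IHk-/(_ lG) //|].
case/flatten_mapP=> M Mgen /mapP[m /IHk-/(_ lG)[h Gh ->] ->].
have [g Gg gM] := gens_G0 Mgen.
exists (g * h)%g; first exact: (@GL_groupM _ _ G0_group).
by rewrite apM gM.
Qed.

(** Elements of G^0 act monomially on the E_ijk, because GL(V_2) permutes the u_i. *)
Lemma G0_E (g : GL8) : g \in G0_segre -> exists (s : 'S_3) (p : 'I_3 -> 'I_3 -> 'I_3),
  (forall m, injective (p m)) /\
  (forall t, ap g (E t) = E (fun m => p m (t (s m)))).
Proof.
case/imset2P=> n f /N0P[a [/is_tensorP na _]] /factor_permsP[s fs] ->.
have ex m i : exists j, GLval (a m) *m u i == u j.
  by have [j ->] := GL2_u (a m) i; exists j.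
exists s, (fun m i => xchoose (ex m i)).
have pE m i : GLval (a m) *m u i = u (xchoose (ex m i)) := eqP (xchooseP (ex m i)).
split=> [m i j eq_p | t]; last first.
  by rewrite apM fs na; apply: tensor_ext => m; apply: pE.
apply/u_inj/(@GL2_u_inj (a m)).
by apply: etrans (pE m i) (etrans _ (esym (pE m j))); rewrite eq_p.
Qed.

Definition G0_invariant (A : {set V8}) : Prop :=
  {in G0_segre & A, forall (g : GL8) v, ap g v \in A}.

Lemma G0_invariant_iff A (g : GL8) v : G0_invariant A -> g \in G0_segre ->
  (ap g v \in A) = (v \in A).
Proof.
move=> invA Gg; apply/idP/idP => [gvA|]; last exact: invA.
by rewrite -(apK g v) invA // (@GL_groupV _ _ G0_group).
Qed.

Lemma segre_invariant : G0_invariant segre.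
Proof.
move=> g v /G0_E[s [p [_ gE]]] /imsetP[t _ ->].
by rewrite gE E_segre.
Qed.

Definition G0_commutes (h : GL8) : Prop :=
  forall (g : GL8) v, g \in G0_segre -> ap g (ap h v) = ap h (ap g v).

Lemma im_invariant (h : GL8) A : G0_commutes h ->
  G0_invariant A -> G0_invariant (im h A).
Proof.
move=> hG invA g v Gg; rewrite !mem_im => hv.
have -> : ap h^-1%g (ap g v) = ap g (ap h^-1%g v).
  by rewrite -{1}(apVK h v) hG // apK.
exact: invA.
Qed.

Lemma span_map (g : GL8) (X Y : seq V8) v :
  {in X, forall x, ap g x \in <<Y>>%VS} -> v \in <<X>>%VS -> ap g v \in <<Y>>%VS.
Proof.
elim: X v => [|a X IHX] v gX.
  by rewrite span_nil memv0 => /eqP->; rewrite mulmx0 mem0v.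
rewrite span_cons => /memv_addP[_ /vlineP[c ->] [w Xw ->]].
rewrite mulmxDr -scalemxAr; apply: memvD; first by rewrite memvZ ?gX ?mem_head.
by apply: IHX => // x Xx; rewrite gX // inE Xx orbT.
Qed.

Lemma pspan_map (g : GL8) (A B : {set V8}) v :
  {in A, forall x, ap g x \in B} -> v \in pspan A -> ap g v \in pspan B.
Proof.
move=> gA; rewrite !inE => /andP[nz vA]; apply/andP; split.
  by rewrite -[0](mulmx0 _ (GLval g)) (inj_eq (@ap_inj g)).
by apply: span_map vA => x; rewrite mem_enum => Ax; apply: memv_span; rewrite mem_enum gA.
Qed.

Lemma O2_invariant : G0_invariant O2.
Proof.
move=> g v Gg; rewrite !in_setD (G0_invariant_iff _ segre_invariant Gg).
case/andP=> -> /bigcupP[m _ /bigcupP[c _ vmc]] /=.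
have [s [p [_ gE]]] := G0_E Gg.
apply/bigcupP; exists ((s^-1)%g m) => //; apply/bigcupP; exists (p ((s^-1)%g m) c) => //.
apply: pspan_map vmc => _ /imsetP[t /[1!inE] /eqP tm ->]; rewrite gE.
have [t' t'E] := ETP (fun m => p m (t (s m))); rewrite t'E; apply: imset_f.
by rewrite inE -(E_inj t'E) permKV tm.
Qed.

Lemma O3P v : reflect (exists t t', (forall m, t m != t' m) /\ v = E t + E t') (v \in O3).
Proof.
apply: (iffP imsetP) => [[[t t'] /[1!inE] /forallP tt' ->]|[t [t' [tt' ->]]]].
  by exists t, t'.
exists (finfun t, finfun t').
  by rewrite inE; apply/forallP=> m; rewrite !ffunE.
by congr (_ + _); apply: tensor_ext => m; rewrite ffunE.
Qed.

Lemma O3_invariant : G0_invariant O3.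
Proof.
move=> g v /G0_E[s [p [p_inj gE]]] /O3P[t [t' [tt' ->]]].
rewrite mulmxDr !gE; apply/O3P.
exists (fun m => p m (t (s m))), (fun m => p m (t' (s m))); split=> // m.
by rewrite (inj_eq (@p_inj m)).
Qed.

Lemma tangents_segreP L : reflect
  (exists t : triple, L = [set E t; ap W (E t); ap W (ap W (E t))]) (L \in tangents_segre).
Proof.
apply: (iffP imsetP) => [[_ /imsetP[t _ ->] ->]|[t ->]].
  by exists t; rewrite tangentE.
by exists (E t); rewrite ?E_segre ?tangentE.
Qed.

Lemma apWW v : ap (W ^+ 2)%g v = ap W (ap W v).
Proof. exact: (apM W W). Qed.

Lemma G0_commutes_W : G0_commutes W.
Proof. move=> g v /W_G0 gW; by rewrite -(apM g) -(apM W) gW. Qed.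

Lemma G0_commutes_WW : G0_commutes (W ^+ 2)%g.
Proof. by move=> g v Gg; rewrite !apWW 2?G0_commutes_W. Qed.

Lemma in_im2 v : (v \in im (W ^+ 2)%g segre) = (ap W v \in segre).
Proof.
rewrite -[X in im X](_ : W * W = _)%g // -{1}(W_W_W v).
by rewrite imM !ap_im.
Qed.

Lemma in_im1 v : (v \in im W segre) = (ap W (ap W v) \in segre).
Proof. by rewrite -{1}(W_W_W v) ap_im. Qed.

(** By [tangentE] the points of the tangents are those of S, W(S) and W^2(S), and
    the last two do not meet S. *)
Lemma O4_images : O4 = im W segre :|: im (W ^+ 2)%g segre.
Proof.
apply/setP=> v; rewrite in_setD in_setU in_im1 in_im2.
apply/andP/orP => [[nSv /bigcupP[_ /tangents_segreP[t ->]]]|].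
  rewrite !in_setU !in_set1 => /orP[/orP[]|] /eqP vE; rewrite vE ?W_W_W ?E_segre.
  - by rewrite vE E_segre in nSv.
  - by left.
  by right.
case=> SWv.
  split; first by rewrite -[v]W_W_W W_notin.
  have /imsetP[t _ tE] := SWv; apply/bigcupP; exists (tangent (E t)).
    by apply: imset_f; apply: E_segre.
  by rewrite tangentE -tE W_W_W !inE eqxx orbT.
split; first by rewrite -[v]W_W_W W_W_notin.
have /imsetP[t _ tE] := SWv; apply/bigcupP; exists (tangent (E t)).
  by apply: imset_f; apply: E_segre.
by rewrite tangentE -tE W_W_W !inE eqxx orbT.
Qed.

(** * The six orbits *)

Definition P3 (i j k : nat) : V8 := E (pt [:: i; j; k]).

Lemma code_P3 i j k : [:: i; j; k] \in triples -> code (P3 i j k) = codeE [:: i; j; k].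
Proof. by move=> ijk; rewrite code_E tseq_pt. Qed.

Definition rep1 : V8 := P3 0 0 0 + P3 1 1 1 + P3 2 2 2.
Definition rep2 : V8 := P3 0 0 0 + P3 1 1 0.
Definition rep3 : V8 := P3 0 0 0 + P3 1 1 1.

Lemma code_rep1 : code rep1 = (of_nat 126).
Proof. by rewrite !codeD !code_P3. Qed.
Lemma code_rep2 : code rep2 = (of_nat 5).
Proof. by rewrite !codeD !code_P3. Qed.
Lemma code_rep3 : code rep3 = (of_nat 129).
Proof. by rewrite !codeD !code_P3. Qed.
Lemma code_rep0 : code (P3 0 0 0) = (of_nat 1).
Proof. by rewrite !code_P3. Qed.

(** Nine rounds exhaust the orbits of the representatives used below. *)
Definition orbit_codes (n : num) : seq num := reach 9 [:: n].

Definition flat_codes (m c : nat) : seq num :=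
  span_codes [seq codeE t | t <- triples & nth 0%N t m == c].

Lemma flat_code (m c : 'I_3) v :
  (v \in pspan [set E t | t : triple & t m == c]) = (v != 0) && (code v \in flat_codes m c).
Proof.
rewrite (@pspan_code _ [seq E (pt t) | t <- triples & nth 0%N t m == c]) => [|w].
  rewrite -map_comp /flat_codes; congr (_ && (_ \in span_codes _)).
  by apply/eq_in_map => t; rewrite mem_filter => /andP[_ tT]; rewrite /= code_E tseq_pt.
apply/imsetP/mapP => [[t /[1!inE] /eqP tm ->]|[t]].
  exists (tseq t); last by rewrite (@E_pt t).
  by rewrite mem_filter nth_tseq tm eqxx tseq_triples.
rewrite mem_filter => /andP[/eqP tm tT ->]; exists (pt t) => //.
by rewrite inE; apply/eqP/val_inj; rewrite /= -tm -nth_tseq tseq_pt.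
Qed.

Definition O2_test (n : num) : bool :=
  [&& n \notin S_codes, n != BinNums.N0
    & has (fun m => has (fun c => n \in flat_codes m c) (iota 0 3)) (iota 0 3)].

(** The lists are bound outside the loop so that they are evaluated once. *)
Lemma O2_tests : let l := orbit_codes (of_nat 5) in
  all (fun n => O2_test n == (n \in l)) codes.
Proof. by vm_compute. Qed.

Lemma O2_code v : (v \in O2) = (code v \in orbit_codes (code rep2)).
Proof.
rewrite code_rep2 -(eqP (all_codesP O2_tests v)) /O2_test in_setD segre_code code_eq0.
congr (_ && _); apply/bigcupP/andP => [[m _ /bigcupP[c _]]|[nz]].
  rewrite flat_code => /andP[-> vmc]; split=> //; apply/hasP; exists (val m).
    by rewrite mem_iota /=.
  by apply/hasP; exists (val c); rewrite ?mem_iota /=.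
case/hasP=> m /[!mem_iota] ltm /hasP[c /[!mem_iota] ltc vmc].
exists (Ordinal ltm) => //; apply/bigcupP; exists (Ordinal ltc) => //.
by rewrite flat_code nz.
Qed.

Definition opposite (t t' : seq nat) : bool := all2 (fun i j => i != j) t t'.

Definition O3_pairs : seq num :=
  [seq lxor (codeE pq.1) (codeE pq.2)
     | pq <- [seq (t, t') | t <- triples, t' <- triples] & opposite pq.1 pq.2].

Lemma O3_tests : let l := orbit_codes (of_nat 129) in let pairs := O3_pairs in
  all (fun n => (n \in pairs) == (n \in l)) codes.
Proof. by vm_compute. Qed.

Lemma oppositeP (t t' : 'I_3 -> 'I_3) :
  reflect (forall m, t m != t' m) (opposite (tseq t) (tseq t')).
Proof.
rewrite /opposite !tseq3 /= andbT !(inj_eq val_inj).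
apply: (iffP and3P) => [[n0 n1 n2] m|tt']; last first.
  by split; apply: tt'.
have [->//|n0m] := eqVneq m ord0; have [->//|n1m] := eqVneq m (lift ord0 ord0).
rewrite (_ : m = lift ord0 (lift ord0 ord0)) //; apply: val_inj.
by case: m n0m n1m => [[|[|[|?]]] ?].
Qed.

Lemma O3_code v : (v \in O3) = (code v \in orbit_codes (code rep3)).
Proof.
rewrite code_rep3 -(eqP (all_codesP O3_tests v)).
apply/O3P/mapP => [[t [t' [tt' ->]]]|[[t t']]].
  exists (tseq t, tseq t'); last by rewrite codeD !code_E.
  by rewrite mem_filter allpairs_f ?tseq_triples // andbT; apply/oppositeP.
rewrite mem_filter => /andP[opp /allpairsP[[s s'] [sT s'T [tE t'E]]]] vE.
rewrite /= in opp vE sT s'T; rewrite {}tE {}t'E in opp vE *.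
exists (pt s), (pt s'); split; first by apply/oppositeP; rewrite !tseq_pt.
by apply: code_inj; rewrite codeD !code_E !tseq_pt.
Qed.

Definition O1_test (l2 l3 : seq num) (n : num) : bool :=
  (n != BinNums.N0) && ~~ [|| n \in l2, n \in l3,
     mulc W_cols (mulc W_cols n) \in S_codes, mulc W_cols n \in S_codes | n \in S_codes].

Lemma O1_tests : let l1 := orbit_codes (of_nat 126) in
  let l2 := orbit_codes (of_nat 5) in let l3 := orbit_codes (of_nat 129) in
  all (fun n => O1_test l2 l3 n == (n \in l1)) codes.
Proof. by vm_compute. Qed.

(** O_1 is a complement, so it is determined by the lists for the other sets. *)
Lemma O1_code v : (v \in O1) = (code v \in orbit_codes (code rep1)).
Proof.
rewrite in_setD !in_setU O4_images in_setU in_im1 in_im2 !segre_code !code_W.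
rewrite O2_code O3_code code_rep2 code_rep3 [v \in points]inE -code_eq0.
(* Rewriting with this equation would try to unify the lists of different orbits,
   which evaluates them. *)
rewrite code_rep1; apply: etrans (eqP (all_codesP O1_tests v)).
have regroup (a b c d s nz : bool) :
  ~~ (a || b || (c || d) || s) && nz = nz && ~~ [|| a, b, c, d | s].
  by rewrite andbC -!orbA.
exact: regroup.
Qed.

Lemma S_tests : let l := orbit_codes (of_nat 1) in
  all (fun n => (n \in S_codes) == (n \in l)) codes.
Proof. by vm_compute. Qed.

Lemma S_code v : (v \in segre) = (code v \in orbit_codes (code (P3 0 0 0))).
Proof. by rewrite code_rep0 -(eqP (all_codesP S_tests v)) segre_code. Qed.

Definition G0_transitive (A : {set V8}) (r : V8) : Prop :=
  {in A, forall v, exists2 g : GL8, g \in G0_segre & v = ap g r}.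

Lemma orbit_codes_transitive (A : {set V8}) r :
  (forall v, (v \in A) = (code v \in orbit_codes (code r))) -> G0_transitive A r.
Proof.
by move=> AE v; rewrite AE => /reachP[g Gg /code_inj vE]; exists g.
Qed.

Lemma im_transitive (h : GL8) A r : G0_commutes h ->
  G0_transitive A r -> G0_transitive (im h A) (ap h r).
Proof.
move=> hG trA _ /imsetP[v /trA[g Gg ->] ->]; exists g => //.
by rewrite hG.
Qed.

Lemma G0_orbit A r : G0_invariant A -> G0_transitive A r ->
  {in A, forall p, orbit GL8_action G0_segre p = A}.
Proof. exact: (@orbit_eq G0_group). Qed.

Lemma segre_transitive : G0_transitive segre (P3 0 0 0).
Proof. exact/orbit_codes_transitive/S_code. Qed.

Lemma O1_invariant : G0_invariant O1.
Proof.
move=> g v Gg; rewrite !in_setD !in_setU O4_images !in_setU.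
have mem_g A : G0_invariant A -> (ap g v \in A) = (v \in A).
  by move=> invA; apply: G0_invariant_iff.
rewrite (mem_g _ O2_invariant) (mem_g _ O3_invariant) (mem_g _ segre_invariant).
rewrite (mem_g _ (im_invariant G0_commutes_W segre_invariant)).
rewrite (mem_g _ (im_invariant G0_commutes_WW segre_invariant)).
case/andP=> -> /=; rewrite !inE; apply: contra_neq => gv0.
by apply: (@ap_inj g); rewrite gv0 mulmx0.
Qed.

Lemma O1_orbit : {in O1, forall p, orbit GL8_action G0_segre p = O1}.
Proof. exact/(G0_orbit O1_invariant)/orbit_codes_transitive/O1_code. Qed.

Lemma O2_orbit : {in O2, forall p, orbit GL8_action G0_segre p = O2}.
Proof. exact/(G0_orbit O2_invariant)/orbit_codes_transitive/O2_code. Qed.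

Lemma O3_orbit : {in O3, forall p, orbit GL8_action G0_segre p = O3}.
Proof. exact/(G0_orbit O3_invariant)/orbit_codes_transitive/O3_code. Qed.

Lemma segre_orbit : {in segre, forall p, orbit GL8_action G0_segre p = segre}.
Proof. exact: G0_orbit segre_invariant segre_transitive. Qed.

Lemma im_segre_orbit h : G0_commutes h ->
  {in im h segre, forall p, orbit GL8_action G0_segre p = im h segre}.
Proof.
move=> hG; apply: G0_orbit (im_invariant hG segre_invariant) _.
exact: im_transitive hG segre_transitive.
Qed.

Definition six_sets : seq {set V8} :=
  [:: O1; O2; O3; im W segre; im (W ^+ 2)%g segre; segre].

Definition six_reps : seq V8 :=
  [:: rep1; rep2; rep3; ap W (P3 0 0 0); ap W (ap W (P3 0 0 0)); P3 0 0 0].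

(** The numbers 126, 5 and 129 are the codes of [rep1], [rep2] and [rep3]. *)
Definition six_tests (n : num) : seq bool :=
  [:: n \in orbit_codes (of_nat 126); n \in orbit_codes (of_nat 5);
      n \in orbit_codes (of_nat 129); mulc W_cols (mulc W_cols n) \in S_codes;
      mulc W_cols n \in S_codes; n \in S_codes].

Lemma six_testsE v : [seq v \in A | A : {set V8} <- six_sets] = six_tests (code v).
Proof.
rewrite /= O1_code O2_code O3_code in_im1 in_im2 !segre_code !code_W.
by rewrite code_rep1 code_rep2 code_rep3.
Qed.

(** The six sets are distinct: the i-th representative lies in the i-th set only. *)
Lemma six_reps_tests : [seq six_tests (code r) | r <- six_reps] =
  [seq [seq i == j | j <- iota 0 6] | i <- iota 0 6].
Proof.
rewrite /= !code_W code_rep1 code_rep2 code_rep3 code_rep0.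
by vm_compute.
Qed.

Lemma rep_in i j : (i < 6)%N -> (j < 6)%N ->
  (nth 0 six_reps i \in nth set0 six_sets j) = (i == j).
Proof.
move=> lti ltj.
have := congr1 (fun s => nth false (nth [::] s i) j) six_reps_tests.
rewrite (nth_map 0) // -six_testsE (nth_map set0) // => ->.
by rewrite (nth_map 0%N) ?size_iota // (nth_map 0%N) ?size_iota // !nth_iota.
Qed.

Lemma uniq_six_sets : uniq six_sets.
Proof.
apply/(uniqP set0) => i j /[!inE] lti ltj eq_ij.
by apply/eqP; rewrite -rep_in // -eq_ij rep_in.
Qed.

Lemma six_sets_orbit A : A \in six_sets ->
  {in A, forall p, orbit GL8_action G0_segre p = A}.
Proof.
rewrite !in_cons in_nil orbF => /or4P[||| /or3P[]] /eqP->.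
- exact: O1_orbit.
- exact: O2_orbit.
- exact: O3_orbit.
- exact: im_segre_orbit G0_commutes_W.
- exact: im_segre_orbit G0_commutes_WW.
exact: segre_orbit.
Qed.

Lemma six_sets_cover v : (v \in points) = has (fun A : {set V8} => v \in A) six_sets.
Proof.
have -> : has (fun A : {set V8} => v \in A) six_sets = has id (six_tests (code v)).
  by rewrite -six_testsE has_map.
have chk : let l1 := orbit_codes (of_nat 126) in let l2 := orbit_codes (of_nat 5) in
    let l3 := orbit_codes (of_nat 129) in
    all (fun n => (n != BinNums.N0) ==  [|| n \in l1, n \in l2, n \in l3,
      mulc W_cols (mulc W_cols n) \in S_codes, mulc W_cols n \in S_codes,
      n \in S_codes | false])
    codes by vm_compute.
rewrite inE -code_eq0; exact: (eqP (all_codesP chk v)).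
Qed.

Lemma point_orbits_six : point_orbits G0_segre = [set A in six_sets].
Proof.
apply/setP=> A; rewrite inE; apply/imsetP/idP => [[p]|Ain].
  rewrite six_sets_cover => /hasP[B Bin pB] ->.
  by rewrite (six_sets_orbit Bin pB).
have lti : (index A six_sets < 6)%N by rewrite -[6%N]/(size six_sets) index_mem.
have rA : nth 0 six_reps (index A six_sets) \in A.
  by have := rep_in lti lti; rewrite nth_index // eqxx.
exists (nth 0 six_reps (index A six_sets)); last by rewrite (six_sets_orbit Ain rA).
by rewrite six_sets_cover; apply/hasP; exists A.
Qed.

(** * The centraliser of G^0 *)

Lemma conjsg_comm (gT : finGroupType) (A : {set gT}) (w : gT) :
  {in A, forall g, (g * w = w * g)%g} -> (A :^ w^-1)%g = A.
Proof.
move=> Aw; apply/setP=> x; rewrite mem_conjgV; apply/idP/idP => [|Ax].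
  by move=> Axw; rewrite -[x](conjgK w) conjgE invgK mulgA -Aw // mulgK.
by rewrite conjgE Aw // mulKg.
Qed.

Lemma GL_conjsg_comm (F : finComUnitRingType) n (A : {set {'GL_n[F]}}) (w : {'GL_n[F]}) :
  {in A, forall g : {'GL_n[F]}, (g * w = w * g)%g} -> (A :^ w^-1)%g = A.
Proof. exact: conjsg_comm. Qed.

Lemma G0_eq (w : GL8) :
  {in G0_segre, forall g : GL8, (g * w = w * g)%g} -> G0 w = G0_segre.
Proof. exact: GL_conjsg_comm. Qed.

Lemma G0_1 : G0 1%g = G0_segre.
Proof. by apply: G0_eq => g _; rewrite mulg1 mul1g. Qed.

Lemma G0_W : G0 W = G0_segre.
Proof. exact/G0_eq/W_G0. Qed.

Lemma G0_WW : G0 (W ^+ 2)%g = G0_segre.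
Proof.
apply: G0_eq => g Gg; apply: GL8_E_inj => t.
by rewrite (apM g) (apM _ g) G0_commutes_WW.
Qed.

Lemma W_cube : (W * (W * W) = 1)%g.
Proof. by apply: GL8_E_inj => t; rewrite !apM W_W_W ap1. Qed.

Lemma W_order : #[W]%g = 3%N.
Proof.
apply: nt_prime_order => //; first exact: W_cube.
apply/eqP=> W1; have := W_notin (E_segre (pt [:: 0; 0; 0]%N)).
by rewrite W1 ap1 E_segre.
Qed.

(** The number 1 is the code of E_000, which the three maps fix: the vectors that
    they all fix form the tangent at E_000. *)
Lemma fixed_codes : all (fun n =>
  [&& n != BinNums.N0, mulc (cols flip12) n == n, mulc (cols swap12) n == n
    & mulc (cols swap23) n == n] ==> (n \in tangent_codes (of_nat 1))) codes.
Proof. by vm_compute. Qed.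

(** If g in G^0 fixes p, then g fixes c p as well. *)
Lemma commuting_fixes (c : GL8) : {in G0_segre, forall g : GL8, (c * g = g * c)%g} ->
  let p := P3 0 0 0 in
  [\/ ap c p = p, ap c p = ap W p | ap c p = ap W (ap W p)].
Proof.
move=> cG p; have := all_codesP fixed_codes (ap c p).
have fixed M : M \in gens -> mulc M (of_nat 1) == of_nat 1 ->
    mulc M (code (ap c p)) == code (ap c p).
  case/gens_G0=> g Gg gM; rewrite -code_rep0 -!gM -/p (inj_eq code_inj) => /eqP gp.
  by rewrite -apM -cG // apM gp.
rewrite (fixed (cols flip12)) // (fixed (cols swap12)) // (fixed (cols swap23)) //.
rewrite code_eq0 -code_rep0 /tangent_codes -!code_W.
have -> : ap c p != 0.
  apply/eqP=> cp0; have := code_rep0; rewrite -/p -(apK c p) cp0 mulmx0.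
  by rewrite code0.
rewrite !in_cons in_nil orbF => /or3P[] /eqP /code_inj.
- by constructor 1.
- by constructor 2.
by constructor 3.
Qed.

Lemma commuting_eq (c w : GL8) :
  {in G0_segre, forall g : GL8, (c * g = g * c)%g} -> G0_commutes w ->
  ap c (P3 0 0 0) = ap w (P3 0 0 0) -> c = w.
Proof.
move=> cG wG cw; apply: GL8_E_inj => t.
have [g Gg ->] := segre_transitive (E_segre t).
by rewrite -apM cG // apM cw wG.
Qed.

Lemma GL_centP (F : finComUnitRingType) n (A : {set {'GL_n[F]}}) (c : {'GL_n[F]}) :
  reflect {in A, forall g : {'GL_n[F]}, (c * g = g * c)%g} (c \in 'C(A))%g.
Proof. exact: centP. Qed.

Lemma GL_cycle_sub (F : finComUnitRingType) n (w : {'GL_n[F]}) (A : {set {'GL_n[F]}}) :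
  w \in 'C(A)%g -> (<[w]> \subset 'C(A))%g.
Proof. by rewrite cycle_subG. Qed.

Lemma GL_mem_cycle (F : finComUnitRingType) n (w : {'GL_n[F]}) k : (w ^+ k)%g \in <[w]>%g.
Proof. exact: mem_cycle. Qed.

Lemma centralizer_G0 : 'C(G0_segre)%g = <[W]>%g.
Proof.
apply/eqP; rewrite eqEsubset; apply/andP; split; last first.
  by apply/GL_cycle_sub/GL_centP => g /W_G0->.
apply/subsetP=> c /GL_centP cG; have [cp|cp|cp] := commuting_fixes cG.
- have G0_commutes_1 : G0_commutes 1%g by move=> g v _; rewrite !ap1.
  rewrite (commuting_eq cG G0_commutes_1 (etrans cp (esym (ap1 _)))).
  exact: (GL_mem_cycle W 0).
- rewrite (commuting_eq cG G0_commutes_W cp); exact: (GL_mem_cycle W 1).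
rewrite (commuting_eq cG G0_commutes_WW (etrans cp (esym (apWW _)))).
exact: (GL_mem_cycle W 2).
Qed.

(** * Counting points and tangents *)

Lemma tangent_cases (t : triple) v : v \in tangent (E t) ->
  [\/ v = E t, v = ap W (E t) | v = ap W (ap W (E t))].
Proof.
rewrite tangentE 2!in_setU 3!in_set1 -orbA => /or3P[] /eqP vE.
- by constructor 1.
- by constructor 2.
by constructor 3.
Qed.

Lemma tangents_fixed (w : GL8) :
  {in tangents_segre, forall L : {set V8}, im w L = L} -> tangents w = tangents_segre.
Proof. by move=> wE; rewrite -[RHS]imset_id; apply: eq_in_imset. Qed.

Lemma W_tangent : {in tangents_segre, forall L : {set V8}, im W L = L}.
Proof.
move=> L /tangents_segreP[t ->]; apply: im_sub_eq => v.
by rewrite !in_setU !in_set1 => /orP[/orP[]|] /eqP->; rewrite ?W_W_W eqxx ?orbT.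
Qed.

Lemma imWW A : im (W ^+ 2)%g A = im W (im W A).
Proof. exact: (imM W W). Qed.

Lemma tangents1 : tangents 1%g = tangents_segre.
Proof. by apply: tangents_fixed => L _; rewrite im1. Qed.

Lemma tangentsW : tangents W = tangents_segre.
Proof. exact/tangents_fixed/W_tangent. Qed.

Lemma tangentsWW : tangents (W ^+ 2)%g = tangents_segre.
Proof. by apply: tangents_fixed => L tL; rewrite imWW !W_tangent. Qed.

Lemma card_segre : #|segre| = 27%N.
Proof.
rewrite card_imset => [|t t' /E_inj tt']; last exact/ffunP.
by rewrite card_ffun !card_ord.
Qed.

Lemma card_tangents : #|tangents_segre| = 27%N.
Proof.
rewrite card_in_imset ?card_segre // => _ _ /imsetP[t _ ->] /imsetP[t' _ ->] eq_tt'.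
have /tangent_cases[//|tt'|tt'] : E t \in tangent (E t') by rewrite -eq_tt' setU11.
  by have := W_notin (E_segre t'); rewrite -tt' E_segre.
by have := W_W_notin (E_segre t'); rewrite -tt' E_segre.
Qed.

Lemma disjoint_images : [disjoint im W segre & im (W ^+ 2)%g segre].
Proof.
apply/pred0P=> v /=; rewrite in_im1 in_im2.
by apply/negP=> /andP[SWWv /W_notin]; rewrite SWWv.
Qed.

Lemma card_O4 : #|O4| = 54%N.
Proof.
rewrite O4_images cardsU disjoint_setI0 ?disjoint_images //.
by rewrite cards0 !card_im card_segre.
Qed.

(** * The interchanges *)

Lemma J_J v : ap J (ap J v) = v.
Proof.
by have := congr1 (fun A => A *m v) J_squared; rewrite mul1mx -!mulmxA.
Qed.

Lemma J_segre : J \in stab segre.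
Proof. by apply/stabP/im_sub_eq => _ /imsetP[t _ ->]; rewrite J_E E_segre. Qed.

Lemma J_W_codes : all (fun t => mulc J_cols (mulc W_cols (codeE t))
  == mulc W_cols (mulc W_cols (mulc J_cols (codeE t)))) triples.
Proof. by vm_compute. Qed.

(** J acts on each factor as an element outside H, and three is odd, so it carries
    W to W + 1 = W^2. *)
Lemma J_W : (J * W = W * W * J)%g.
Proof.
apply: GL8_E_inj => t; apply: code_inj; rewrite !apM !(code_J, code_W) code_E.
exact: (eqP (all_triplesP J_W_codes t)).
Qed.

Lemma W_W_W_im A : im W (im W (im W A)) = A.
Proof. by rewrite -(imM W W A) -imM W_cube im1. Qed.

Lemma stab_images_cases (g : GL8) : g \in stab segre ->
  (im g (im W segre) = im W segre /\ im g (im (W ^+ 2)%g segre) = im (W ^+ 2)%g segre) \/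
  (im g (im W segre) = im (W ^+ 2)%g segre /\ im g (im (W ^+ 2)%g segre) = im W segre).
Proof.
move=> Sg; have gS := stabP _ _ Sg; rewrite !imWW.
have [gW|gW] := stab_normalises_W Sg.
  have gWA A : im g (im W A) = im W (im g A) by rewrite -!imM gW.
  by left; rewrite !gWA gS.
have gWA A : im g (im W A) = im W (im W (im g A)) by rewrite -imM gW !imM.
by right; rewrite !gWA gS W_W_W_im.
Qed.

Lemma J_interchanges : interchanges J (im W segre) (im (W ^+ 2)%g segre).
Proof.
have JW A : im J (im W A) = im W (im W (im J A)) by rewrite -imM J_W !imM.
by rewrite /interchanges imWW !JW (stabP _ _ J_segre) W_W_W_im.
Qed.

Lemma effects_S : effects_interchange (stab segre) (im W segre) (im (W ^+ 2)%g segre).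
Proof.
split=> [g /stab_images_cases[[-> ->] //|[-> ->]]|]; first by rewrite setUC.
by exists J; [exact: J_segre | exact: J_interchanges].
Qed.

Lemma im_stab (h g : GL8) A : g \in stab A -> (h * g * h^-1)%g \in stab (im h A).
Proof.
move/stabP=> gA; apply/stabP.
by rewrite !imM -(imM h^-1%g h) mulVg im1 gA.
Qed.

Lemma im_interchanges (h g : GL8) A B :
  interchanges g A B -> interchanges (h * g * h^-1)%g (im h A) (im h B).
Proof.
case=> gA gB; split; by rewrite !imM -(imM h^-1%g h) mulVg im1 ?gA ?gB.
Qed.

(** Transport of structure by h. *)
Lemma im_effects (h : GL8) A B C : effects_interchange (stab A) B C ->
  effects_interchange (stab (im h A)) (im h B) (im h C).
Proof.
case=> effA [g gA gBC]; split; last first.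
  exists (h * g * h^-1)%g; [exact: im_stab | exact: im_interchanges].
move=> k kA; pose k' := (h^-1 * k * h)%g.
have k'A : k' \in stab A.
  by apply/stabP; rewrite /k' !imM (stabP _ _ kA) -imM mulVg im1.
have kE D : im k (im h D) = im h (im k' D).
  by rewrite /k' -!imM !mulgA mulgV mul1g.
have := congr1 (fun X : {set {set V8}} => im h @: X) (effA _ k'A).
by rewrite !kE !imsetU1 !imset_set1.
Qed.

Lemma stab_O4 (g : GL8) : g \in stab segre -> im g O4 = O4.
Proof.
move=> Sg; have imU A B : im g (A :|: B) = im g A :|: im g B by apply: imsetU.
rewrite O4_images imU; have [[-> ->]//|[-> ->]] := stab_images_cases Sg.
exact: setUC.
Qed.

Lemma G0_sub_stab (g : GL8) : g \in G0_segre -> g \in stab segre.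
Proof. by move=> Gg; apply/stabP/im_sub_eq => v; apply: segre_invariant. Qed.

Lemma stab_O4_transitive : {in O4, forall v,
  exists2 g : GL8, g \in stab segre & v = ap g (ap W (P3 0 0 0))}.
Proof.
have transW w : w \in segre ->
    exists2 g : GL8, g \in stab segre & ap W w = ap g (ap W (P3 0 0 0)).
  case/segre_transitive=> g Gg ->; exists g; first exact: G0_sub_stab.
  by rewrite G0_commutes_W.
move=> v; rewrite O4_images in_setU in_im1 in_im2 => /orP[/transW[g Sg]|Wv].
  by rewrite W_W_W => ->; exists g.
have JWv : ap J (ap W v) \in segre by rewrite -(stabP _ _ J_segre) ap_im.
have [g Sg gE] := transW _ JWv; exists (J * g)%g.
  exact: (@GL_groupM _ _ (astabs_group GL8_action segre)) J_segre Sg.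
by rewrite apM -gE -(apM J W) J_W !apM J_J W_W_W.
Qed.

Lemma O4_orbit : O4 \in point_orbits (stab segre).
Proof.
pose p := ap W (P3 0 0 0).
have pO4 : p \in O4 by rewrite O4_images in_setU ap_im E_segre.
apply/imsetP; exists p.
  rewrite six_sets_cover; apply/hasP; exists (im W segre); last by rewrite ap_im E_segre.
  by rewrite !in_cons eqxx !orbT.
apply/esym.
apply: (@orbit_eq (astabs_group GL8_action segre) _ p) pO4; last exact: stab_O4_transitive.
by move=> g v /stab_O4 gO4; rewrite -{2}gO4 ap_im.
Qed.

Lemma effects_sym (G : {set GL8}) A B :
  effects_interchange G A B -> effects_interchange G B A.
Proof.
case=> eff [g Gg [gA gB]]; split=> [h Gh|]; last by exists g.
by rewrite setUC eff // setUC.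
Qed.

Lemma effects_S' : effects_interchange (stab (im W segre)) segre (im (W ^+ 2)%g segre).
Proof.
by have /effects_sym := im_effects W effects_S; rewrite !imWW W_W_W_im.
Qed.

Lemma effects_S'' :
  effects_interchange (stab (im (W ^+ 2)%g segre)) segre (im W segre).
Proof.
by have := im_effects (W ^+ 2)%g effects_S; rewrite !imWW !W_W_W_im.
Qed.

Lemma GL_orderJ (F : finComUnitRingType) n (g h : {'GL_n[F]}) :
  #[(h * g * h^-1)%g]%g = #[g]%g.
Proof. by rewrite -(orderJ g h^-1%g) conjgE invgK mulgA. Qed.

Lemma J_order : #[J]%g = 2%N.
Proof.
apply: nt_prime_order => //; first by apply: GL8_E_inj => t; rewrite (apM J J) J_J ap1.
apply/eqP=> J1; have := J_E (fun=> 0); rewrite J1 ap1 => /E_inj/(_ 0)/eqP.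
by [].
Qed.

Lemma J_W_ap v : ap J (ap W v) = ap W (ap W (ap J v)).
Proof. by rewrite -(apM J W) J_W !apM. Qed.

Lemma conj_eq (h j k l : GL8) :
  (forall v, ap h (ap j v) = ap k (ap l (ap h v))) -> (h * j * h^-1 = k * l)%g.
Proof.
move=> hj; apply: GL8_E_inj => t; rewrite -(apVK h (E t)) (apM (h * j)%g) apK.
by rewrite (apM h j) (apM k l).
Qed.

(** W J W^-1 = W^2 J amounts to W J = W^2 J W, and J W = W^2 J with W^3 = 1. *)
Lemma J'E : (W * J * W^-1 = W ^+ 2 * J)%g.
Proof. by apply: conj_eq => v; rewrite apWW J_W_ap W_W_W. Qed.

Lemma J''E : (W ^+ 2 * J * (W ^+ 2)^-1 = W * J)%g.
Proof. by apply: conj_eq => v; rewrite !apWW !J_W_ap !W_W_W. Qed.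

Lemma interchanges_sym g A B : interchanges g A B -> interchanges g B A.
Proof. by case. Qed.

Lemma J'_interchanges :
  interchanges (W * J * W^-1)%g segre (im (W ^+ 2)%g segre).
Proof.
have := im_interchanges W J_interchanges; rewrite !imWW W_W_W_im.
exact: interchanges_sym.
Qed.

Lemma J''_interchanges :
  interchanges (W ^+ 2 * J * (W ^+ 2)^-1)%g segre (im W segre).
Proof.
by have := im_interchanges (W ^+ 2)%g J_interchanges; rewrite !imWW !W_W_W_im.
Qed.

Lemma six_sets_set :
  [set A in six_sets] = [set O1; O2; O3; im W segre; im (W ^+ 2)%g segre; segre].
Proof. by apply/setP=> A; rewrite !inE -!orbA. Qed.
End Segre.

Theorem mainTheorem3 :
  let S := segre in
  let S' := im W segre in
  let S'' := im (W ^+ 2) segre in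
  let J' := W * J * W^-1 in
  let J'' := W ^+ 2 * J * (W ^+ 2)^-1 in
  (* (a) *)
  [/\ O4 = S' :|: S'', [disjoint S' & S''], O4 \in point_orbits (stab S)
    & #|O4| = 54] /\
  (* (b) *)
  [/\ tangents W = tangents 1, tangents (W ^+ 2) = tangents 1
    & #|tangents 1| = 27] /\
  [/\ #[W] = 3, 'C(G0 1) = <[W]>, 'C(G0 W) = <[W]>
    & 'C(G0 (W ^+ 2)) = <[W]>] /\
  (* (c) *)
  [/\ G0 W = G0 1, G0 (W ^+ 2) = G0 1,
      point_orbits (G0 1) = [set O1; O2; O3; S'; S''; S]
    & #|[set O1; O2; O3; S'; S''; S]| = 6] /\
  (* (d) *)
  [/\ effects_interchange (stab S) S' S'',
      effects_interchange (stab S') S S''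
    & effects_interchange (stab S'') S S'] /\
  [/\ #[J] = 2, J \in stab S & interchanges J S' S''] /\
  [/\ J' = W ^+ 2 * J, #[J'] = 2, J' \in stab S' & interchanges J' S S''] /\
  [/\ J'' = W * J, #[J''] = 2, J'' \in stab S'' & interchanges J'' S S'].
Proof.
move=> S S' S'' J' J''.
split; first exact: And4 O4_images disjoint_images O4_orbit card_O4.
split; first by rewrite tangentsW tangentsWW tangents1; split=> //; exact: card_tangents.
split.
  rewrite G0_W G0_WW G0_1.
  exact: And4 W_order centralizer_G0 centralizer_G0 centralizer_G0.
split.
  rewrite G0_W G0_WW G0_1 -six_sets_set; split=> //; first exact: point_orbits_six.
  by rewrite cardsE (card_uniqP uniq_six_sets).
split; first exact: And3 effects_S effects_S' effects_S''.
split; first exact: And3 J_order J_segre J_interchanges.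
split; first exact: And4 J'E (etrans (GL_orderJ _ _) J_order) (im_stab W J_segre) J'_interchanges.
exact: And4 J''E (etrans (GL_orderJ _ _) J_order) (im_stab (W ^+ 2) J_segre) J''_interchanges.
Qed.
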